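(* Let $G$ be a finite group. Then $G$ is a $9$-centralizer group if and only if $\frac{G}{Z(G)}\cong C_7 \rtimes C_2$ or $\frac{G}{Z(G)}\cong C_7 \rtimes C_3$ or $\frac{G}{Z(G)}\cong (C_6, C_7)$ or $\frac{G}{Z(G)}\cong C_7 \times C_7$.
   Context: For a finite group $G$, $Z(G)$ denotes the center of $G$, and for $x\in G$, $C(x)$ denotes the centralizer of $x$ in $G$. Let $Cent(G)=\{C(x)\mid x\in G\}$ be the set of distinct centralizers of elements of $G$. The group $G$ is called $n$-centralizer if $|Cent(G)|=n$. $C_n$ denotes the cyclic group of order $n$. $C_7\rtimes C_2$ and $C_7\rtimes C_3$ denote the semidirect products, with normal subgroup $C_7$ and nontrivial action, i.e. the non-abelian groups of order $14$ and $21$ respectively (each unique up to isomorphism). $(C_6,C_7)$ denotes the Frobenius group with complement $C_6$ and kernel $C_7$ (of order $42$, unique up to isomorphism). *)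

(* Defs.v *)
From mathcomp Require Import all_boot all_fingroup all_algebra all_solvable.

Set Implicit Arguments.
Unset Strict Implicit.
Unset Printing Implicit Defensive.

Local Open Scope group_scope.

Section CentralizerGroups.

Variable gT : finGroupType.
Implicit Types G Q : {group gT}.

Definition Cent G : {set {set gT}} := [set 'C_G[x] | x in G].

Definition n_centralizer n G : Prop := #|Cent G| = n.

(* Q is, up to isomorphism, a semidirect product of the cyclic groups C_m      *)
(* (normal factor) and C_n for a nontrivial action. Both factors are subgroups *)
(* of Q, so C_n acts by conjugation; the action is trivial iff H centralises K.*)
Definition is_nontrivial_sdprod_cyclic m n Q : Prop :=
  exists K H : {group gT},
    [/\ K ><| H = Q, K \isog Zp m, H \isog Zp n & ~~ (H \subset 'C(K))].

Definition is_Frobenius_cyclic n m Q : Prop :=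
  exists K H : {group gT},
    [/\ [Frobenius Q = K ><| H], H \isog Zp n & K \isog Zp m].

End CentralizerGroups.

(* Main.v *)
Require Import Defs.
From mathcomp Require Import all_boot all_fingroup all_algebra all_solvable.
From mathcomp Require Import vcharacter zify.

Set Implicit Arguments.
Unset Strict Implicit.
Unset Printing Implicit Defensive.

Local Open Scope group_scope.

(** Let Z be the centre of G and suppose that G has exactly nine centralizers.
    A noncentral x lies in the centre of its own centralizer, so G is covered by
    eight abelian subgroups which contain Z; they cannot all have index at least 8,
    and an abelian subgroup A of maximal order has index at most 7
    ([nine_cent_ab_max_index]).

    Such an A may be taken normal ([nine_cent_normal_ab_max]). If its index p is
    prime and A differs from a conjugate A^g, the two generate G, so they meet inside
    Z and A has order less than p|Z|; but Cauchy's theorem in G/Z provides an abelian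
    subgroup of order p|Z| ([ab_max_prime_index_normal]). For index 4 or 6, either A
    is a maximal subgroup, which makes G/Z a Frobenius group with complement A/Z, or
    there is a group between A and G; each situation produces another abelian subgroup
    of the same order which is normal, or contradicts the maximality of A or the
    number of centralizers ([nine_cent_maximal_normal], [ab_max_index2_normal],
    [ab_max_index3_normal], [ab_max_index3_nonnormal]).

    Now G/A has order at most 7, so it is cyclic, a Klein group, or nonabelian of
    order 6. The counts rest on one remark: if t and ta, with a in A, have the same
    centralizer, then they commute and a lies in C_A(t). So the coset tA accounts for
    at least |A : C_A(t)| centralizers ([leq_ncent_cosets]). In the two noncyclic
    cases this leads to at least ten centralizers, or to an even number of them
    ([order6_nonabelian_ncent], [nine_cent_index4_cyclic]). In the cyclic case it does so too,
    unless C_A(t) = Z for all t outside A ([cyclic_nine_cent]). When this holds and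
    y generates G modulo A, the centralizers are G, A and those of the elements ya,
    which correspond to the cosets of Z in A; their number is |A : Z| + 2
    ([cyclic_quotient_ncent]). Hence |A : Z| = 7, and the four groups in the theorem
    are the possible extensions: the quotient G/Z has order 49, or it is a Frobenius
    group with kernel A/Z of order 7 and cyclic complement ([nine_cent_structure]).

    Conversely, for each of the four quotients the preimage A of a subgroup of order 7
    satisfies C_A(t) = Z for all t outside A, and the same formula gives 7 + 2
    centralizers ([nine_cent_of_kernel]). *)

(** * Counting centralizers *)

(** Counting over a subset [S] of [G] lets lower bounds on disjoint pieces of [G]
    be added; [ncent G G] is the number of centralizers in [G]. *)
Definition ncent (gT : finGroupType) (G S : {set gT}) : nat :=
  #|[set 'C_G[x] | x in S]|.

Lemma ncentS (gT : finGroupType) (G S T : {set gT}) :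
  S \subset T -> ncent G S <= ncent G T.
Proof. by move=> sST; apply: subset_leq_card; apply: imsetS. Qed.

(** This is how lower bounds are assembled: pieces of [G] that share no
    centralizer contribute separately. *)
Lemma ncentU (gT : finGroupType) (G S T : {set gT}) :
  {in S & T, forall x u, 'C_G[x] != 'C_G[u]} ->
  ncent G (S :|: T) = ncent G S + ncent G T.
Proof.
move=> neqST; rewrite /ncent imsetU cardsU (_ : _ :&: _ = set0) ?cards0 ?subn0 //.
apply/setP=> C; rewrite !inE; apply/andP=> -[/imsetP[x Sx ->] /imsetP[u Tu eqC]].
by case/eqP: (neqST x u Sx Tu).
Qed.

Lemma ncentU_le (gT : finGroupType) (G S T : {set gT}) :
  ncent G (S :|: T) <= ncent G S + ncent G T.
Proof. by rewrite /ncent imsetU cardsU leq_subr. Qed.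

Lemma card_imset_fibres (aT rT : finType) (f : aT -> rT) (S : {set aT}) :
  #|S| = \sum_(C in f @: S) #|[set u in S | f u == C]|.
Proof.
rewrite -sum1_card (partition_big_imset f) /=.
by apply: eq_bigr => C _; rewrite -sum1_card; apply: eq_bigl => u; rewrite inE.
Qed.

Lemma leq_card_fibres (aT rT : finType) (f : aT -> rT) (S : {set aT}) d :
  {in S, forall t, #|[set u in S | f u == f t]| <= d} -> #|S| <= #|f @: S| * d.
Proof.
move=> fib_le; rewrite (card_imset_fibres f) -sum_nat_const.
by apply: leq_sum => _ /imsetP[t St ->]; apply: fib_le.
Qed.

Lemma ltn_card_fibres (aT rT : finType) (f : aT -> rT) (S : {set aT}) d t0 :
    {in S, forall t, #|[set u in S | f u == f t]| <= d} ->
    t0 \in S -> #|[set u in S | f u == f t0]| < d ->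
  #|S| < #|f @: S| * d.
Proof.
move=> fib_le St0 fib_lt; rewrite (card_imset_fibres f) -sum_nat_const.
have ft0: f t0 \in f @: S by apply: imset_f.
rewrite (bigD1 (f t0)) //= [X in _ < X](bigD1 (f t0)) //= -addSn; apply: leq_add => //.
by apply: leq_sum => _ /andP[/imsetP[t St ->] _]; apply: fib_le.
Qed.

Lemma same_cent_commute (gT : finGroupType) (G : {group gT}) x u :
  u \in G -> 'C_G[u] = 'C_G[x] -> u \in 'C[x].
Proof.
move=> Gu eqC; have: u \in 'C_G[u] by rewrite inE Gu cent1id.
by rewrite eqC => /setIP[].
Qed.

Lemma sub_center_cent1 (gT : finGroupType) (G : {group gT}) x :
  x \in G -> 'Z(G) \subset 'C[x].
Proof. by move=> Gx; rewrite sub_cent1 (subsetP _ x Gx) // centsC subsetIr. Qed.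

Lemma cent1_noncentral (gT : finGroupType) (G : {group gT}) x :
  x \in G -> x \notin 'Z(G) -> 'C_G[x] != 'C_G[1].
Proof.
move=> Gx; apply: contra => /eqP eqC; rewrite inE Gx /= -sub_cent1.
suff <-: 'C_G[x] = G by apply: subsetIr.
by rewrite eqC; apply/setIidPl; rewrite sub_cent1 group1.
Qed.

Lemma cent1_conj (gT : finGroupType) (G : {group gT}) x g :
  g \in G -> 'C_G[x ^ g] = 'C_G[x] :^ g.
Proof. by move=> Gg; rewrite cent1J conjIg (conjGid Gg). Qed.

Lemma cent1_lcoset (gT : finGroupType) (A : {group gT}) t a :
  abelian A -> a \in A -> 'C_A[t * a] = 'C_A[t].
Proof.
move=> abA Aa; apply/setP=> c; rewrite !in_setI; apply: andb_id2l => Ac.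
have cca: a \in 'C[c] by apply/cent1P; apply: (centsP abA).
by rewrite ![c \in _]cent1C groupMr.
Qed.

(** An abelian centralizer is contained in the centralizer of each of its
    elements. *)
Lemma cent1_eq_abelian (gT : finGroupType) (G : {group gT}) t u :
    t \in G -> u \in G -> abelian 'C_G[t] -> abelian 'C_G[u] -> u \in 'C[t] ->
  'C_G[u] = 'C_G[t].
Proof.
have sub v w : v \in G -> abelian 'C_G[w] -> v \in 'C[w] -> 'C_G[w] \subset 'C_G[v].
  move=> Gv abC cvw; rewrite subsetI subsetIl sub_cent1 (subsetP abC) //.
  by rewrite inE Gv.
move=> Gt Gu abt abu cut; apply/eqP; rewrite eqEsubset !sub //.
by rewrite cent1C.
Qed.

Lemma ncent_add (gT : finGroupType) (G S : {set gT}) x :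
  {in S, forall u, 'C_G[u] != 'C_G[x]} -> ncent G (S :|: [set x]) = (ncent G S).+1.
Proof.
move=> neqS; rewrite ncentU; last by move=> u y Su /set1P->; apply: neqS.
by rewrite /ncent imset_set1 cards1 addn1.
Qed.

(** If [t] and [t * a] have the same centralizer they commute, so [a] commutes
    with [t]; hence the elements of a coset of [A] that share the centralizer of
    [t] form at most one coset of [C_A(t)]. *)
Lemma cent_fibre_sub (gT : finGroupType) (G A : {group gT}) (S : {set gT}) t :
    S \subset G -> t \in S ->
    {in S & S, forall v u, 'C_G[u] = 'C_G[v] -> v^-1 * u \in A} ->
  [set u in S | 'C_G[u] == 'C_G[t]] \subset t *: 'C_A[t].
Proof.
move=> sSG St cSA; apply/subsetP=> u; rewrite inE => /andP[Su /eqP eqC].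
have cut := same_cent_commute (subsetP sSG u Su) eqC.
by rewrite mem_lcoset inE cSA //= groupM // groupV cent1id.
Qed.

(** The basic lower bound: the fibres of the centralizer map on [S] have at most
    [d] elements. *)
Lemma leq_ncent_cosets (gT : finGroupType) (G A : {group gT}) (S : {set gT}) d :
    S \subset G -> {in S & S, forall t u, 'C_G[u] = 'C_G[t] -> t^-1 * u \in A} ->
    {in S, forall t, #|'C_A[t]| <= d} ->
  #|S| <= ncent G S * d.
Proof.
move=> sSG cSA cA_le; apply: leq_card_fibres => t St.
apply: leq_trans (cA_le t St); rewrite -(card_lcoset 'C_A[t] t).
exact/subset_leq_card/cent_fibre_sub.
Qed.

(** One strictly smaller fibre improves the bound by one; this extra centralizer
    is what makes several of the counts below reach ten. *)
Lemma ltn_ncent_cosets (gT : finGroupType) (G A : {group gT}) (S : {set gT}) d t b :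
    S \subset G -> {in S & S, forall t u, 'C_G[u] = 'C_G[t] -> t^-1 * u \in A} ->
    {in S, forall t, #|'C_A[t]| <= d} ->
    t \in S -> b \in 'C_A[t] -> 'C_G[t * b] != 'C_G[t] ->
  #|S| < ncent G S * d.
Proof.
move=> sSG cSA cA_le St cAb neqC.
have fib_sub v: v \in S -> [set u in S | 'C_G[u] == 'C_G[v]] \subset v *: 'C_A[v].
  by move=> Sv; apply: cent_fibre_sub.
apply: (ltn_card_fibres (t0 := t)) => // [v Sv|].
  apply: leq_trans (cA_le v Sv); rewrite -(card_lcoset 'C_A[v] v).
  exact/subset_leq_card/fib_sub.
apply: leq_trans (cA_le t St); rewrite -(card_lcoset 'C_A[t] t).
apply/proper_card; rewrite properE fib_sub //; apply/subsetPn; exists (t * b).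
  by rewrite mem_lcoset mulKg.
by rewrite inE negb_and neqC orbT.
Qed.

(** Translation by the centre does not change a centralizer. *)
Lemma leq_ncent_lcoset (gT : finGroupType) (G D Z : {group gT}) y :
  y \in G -> Z \subset 'Z(G) -> ncent G (y *: D) <= #|D : Z|.
Proof.
move=> Gy sZG.
have sub: [set 'C_G[x] | x in y *: D] \subset [set 'C_G[y * repr c] | c in rcosets Z D].
  apply/subsetP=> _ /imsetP[_ /lcosetP[x Dx ->] ->]; apply/imsetP; exists (Z :* x).
    by apply/rcosetsP; exists x.
  have [z /(subsetP sZG)/centerP[_ cz] ->] := rcosetP (mem_repr_rcoset Z x).
  apply/setP=> u; rewrite !in_setI; apply: andb_id2l => Gu.
  have cuz: z \in 'C[u] by apply/cent1P; apply: cz.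
  by rewrite ![u \in _]cent1C mulgA -(cz y Gy) -mulgA (groupMl _ cuz).
apply: leq_trans (subset_leq_card sub) _.
exact: leq_imset_card.
Qed.

(** Here [d] bounds the elements of [S] that commute with a given one together
    with [Z], typically through a subgroup which contains both; as [Z] lies outside
    [S] it may be subtracted. *)
Lemma leq_ncent_cent_bound (gT : finGroupType) (G Z : {group gT}) (S : {set gT}) d :
    S \subset G -> [disjoint S & Z] ->
    {in S, forall t, #|S :&: 'C[t] :|: Z| <= d} ->
  #|S| <= ncent G S * (d - #|Z|).
Proof.
move=> sSG tiSZ dP; apply: leq_card_fibres => t St.
have fsub: [set u in S | 'C_G[u] == 'C_G[t]] \subset S :&: 'C[t].
  apply/subsetP=> u; rewrite !inE => /andP[Su /eqP eqC]; rewrite Su.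
  by have := same_cent_commute (subsetP sSG u Su) eqC; rewrite inE.
apply: leq_trans (subset_leq_card fsub) _; rewrite leq_subRL.
  apply: leq_trans (dP t St); rewrite cardsU (_ : _ :&: Z = set0) ?cards0 ?subn0 1?addnC //.
  apply/eqP; rewrite -subset0; apply: subset_trans (setSI _ (subsetIl _ _)) _.
  by rewrite (disjoint_setI0 tiSZ).
by apply: leq_trans (dP t St); rewrite subset_leq_card // subsetUr.
Qed.

Lemma card_index_meet (gT : finGroupType) (C M L Z : {group gT}) :
  C \subset L -> L \subset 'N(M) -> M \subset L -> C :&: M \subset Z ->
  #|C| <= #|L : M| * #|Z|.
Proof.
move=> sCL nML sML sIZ.
rewrite -(leq_pmul2r (cardG_gt0 M)) mul_cardG -mulnA [(#|Z| * _)%N]mulnC mulnA.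
rewrite [(#|L : M| * _)%N]mulnC Lagrange //.
by rewrite leq_mul // subset_leq_card // mul_subG.
Qed.

(** For [t] in [L] outside [M] the group [C_L(t)] meets [M] in at most [Z], so it
    has at most [#|L : M| * #|Z|] elements, of which at most [(#|L : M| - 1) * #|Z|]
    lie outside [M]. *)
Lemma leq_ncent_setD (gT : finGroupType) (G L M Z : {group gT}) :
    L \subset G -> M <| L -> M \proper L -> Z \subset 'Z(G) -> Z \subset M ->
    {in L :\: M, forall t, 'C_M[t] \subset Z} ->
  #|M : Z| <= ncent G (L :\: M).
Proof.
move=> sLG /andP[sML nML] prML sZG sZM cMZ.
have iLM: 1 < #|L : M| by rewrite indexg_gt1 proper_subn.
have tiSZ: [disjoint L :\: M & Z].
  by rewrite disjoints_subset setDE subIset // setCS sZM orbT.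
have sSG: L :\: M \subset G by rewrite subDset subsetU // sLG orbT.
have dP: {in L :\: M, forall t, #|(L :\: M) :&: 'C[t] :|: Z| <= #|L : M| * #|Z|}.
  move=> t LMt; have [Lt _] := setDP LMt.
  have sC: (L :\: M) :&: 'C[t] :|: Z \subset 'C_L[t].
    rewrite subUset setSI ?subsetDl // subsetI (subset_trans sZM) //=.
    rewrite sub_cent1; apply: subsetP (subsetP sLG t Lt); rewrite centsC.
    by apply: subset_trans sZG (subsetIr _ _).
  apply: leq_trans (subset_leq_card sC) _.
  apply: card_index_meet => //; first exact: subsetIl.
  by apply: subset_trans (cMZ t LMt); rewrite subsetI subsetIr setIAC subsetIr.
have := leq_ncent_cent_bound sSG tiSZ dP.
rewrite cardsD (setIidPr sML) -(Lagrange sML) -(Lagrange sZM).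
set n := ncent _ _; move: (#|L : M|) iLM => k k_gt1.
case: k k_gt1 => [|k] // k_gt0.
rewrite mulSn mulnS [(#|Z| + _)%N]addnC [(_ + _ * k)%N]addnC !addnK.
rewrite [(k * _)%N]mulnC mulnAC mulnC.
by rewrite leq_pmul2r ?muln_gt0 ?cardG_gt0.
Qed.

(** * Subgroups of small index *)

Lemma prime_index_between (gT : finGroupType) (G H K : {group gT}) :
  prime #|G : H| -> H \subset K -> K \subset G -> K = G :> {set gT} \/ K = H :> {set gT}.
Proof.
move=> p_pr sHK sKG; have := Lagrange_index sKG sHK => eqi.
have: #|G : K| %| #|G : H| by rewrite -eqi dvdn_mulr.
have /primeP[_ dvd_p] := p_pr; move/dvd_p; case/orP => [iK1 | /eqP eqiK].
  by left; apply/eqP; rewrite eqEsubset sKG -indexg_eq1.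
right; apply/eqP; rewrite eqEsubset sHK andbT -indexg_eq1.
by rewrite -(eqn_pmul2l (indexg_gt0 G K)) eqi muln1 eqiK.
Qed.

Lemma prime_index_adjoin (gT : finGroupType) (G H : {group gT}) x :
  prime #|G : H| -> H \subset G -> x \in G -> x \notin H -> H <*> <[x]> = G.
Proof.
move=> p_pr sHG Gx nHx.
have sJG: H <*> <[x]> \subset G by rewrite join_subG sHG cycle_subG.
have [// | eqH] := prime_index_between p_pr (joing_subl H <[x]>) sJG.
by case/negP: nHx; move: eqH => /= <-; rewrite mem_gen // inE cycle_id orbT.
Qed.

(** Here [H * H ^ g] has [#|H| ^ 2 / #|H :&: H ^ g|] elements, and it is not all
    of [G]: a factorisation of [g] itself would put [g] in [H]. *)
Lemma ltn_index_conj_inter (gT : finGroupType) (G H : {group gT}) g :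
    H \subset G -> g \in G -> H :^ g != H ->
  #|H| < #|G : H| * #|H :&: H :^ g|.
Proof.
move=> sHG Gg neqH; rewrite -(ltn_pmul2l (cardG_gt0 H)) mulnA Lagrange //.
have {1}<- : #|H :^ g| = #|H| by rewrite cardJg.
rewrite mulnC mul_cardG ltn_pmul2r ?cardG_gt0 //.
apply: proper_card; rewrite properEneq mul_subG ?conj_subG // andbT.
apply: contra neqH => /eqP defG.
have: g \in H * (H :^ g) by rewrite defG.
case/mulsgP=> a _ Ha /imsetP[b Hb ->]; rewrite /conjg => defg.
suff defg': g = b * a by rewrite conjGid // defg' groupM.
have ab1: (a * g^-1) * b = 1 by apply: (mulIg g); rewrite mul1g -!mulgA -defg.
by rewrite -(mulKg (a * g^-1) b) ab1 mulg1 invMg invgK mulgKV.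
Qed.

Lemma leq_double_proper (gT : finGroupType) (A B : {group gT}) :
  B \subset A -> ~~ (A \subset B) -> 2 * #|B| <= #|A|.
Proof.
move=> sBA nAB; rewrite -(Lagrange sBA) mulnC leq_pmul2l ?cardG_gt0 //.
by rewrite indexg_gt1.
Qed.

Lemma expg_index (gT : finGroupType) (G H : {group gT}) x :
  H <| G -> x \in G -> x ^+ #|G : H| \in H.
Proof.
move=> nsHG Gx; have Nx := subsetP (normal_norm nsHG) x Gx.
apply: coset_idr; first exact: groupX.
by rewrite morphX // -card_quotient ?normal_norm // expg_cardG ?mem_quotient.
Qed.

Lemma mem_quotientE (gT : finGroupType) (H A : {group gT}) u :
  H <| A -> u \in 'N(H) -> (coset H u \in A / H) = (u \in A).
Proof.
by move=> nsHA Nu; rewrite -{2}(quotientGK nsHA); apply/idP/morphpreP=> [|[]].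
Qed.

Lemma index2_div (gT : finGroupType) (G L : {group gT}) t u :
    L \subset G -> #|G : L| = 2 -> t \in G :\: L -> u \in G :\: L ->
  t^-1 * u \in L.
Proof.
move=> sLG iL GLt GLu; have [Gu _] := setDP GLu.
have: t \in L :* u by rewrite (rcoset_index2 sLG iL GLu).
case/rcosetP=> h Lh ->; rewrite invMg -mulgA -[_ * (_ * _)]/(h^-1 ^ u).
by rewrite memJ_norm ?groupV // (subsetP (normal_norm (index2_normal sLG iL))).
Qed.

Lemma abelian_order6_cyclic (gT : finGroupType) (Q : {group gT}) :
  abelian Q -> #|Q| = 6 -> cyclic Q.
Proof.
move=> abQ oQ.
have [|x Qx ox] := @Cauchy _ 2 Q isT; first by rewrite oQ.
have [|y Qy oy] := @Cauchy _ 3 Q isT; first by rewrite oQ.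
have oxy: #[x * y] = 6 by rewrite orderM ?ox ?oy //; apply: (centsP abQ).
apply/cyclicP; exists (x * y); apply/eqP.
by rewrite eq_sym eqEcard cycle_subG groupM //= oQ -[#|<[_]>|]/#[x * y] oxy.
Qed.

(** A nonabelian group of order 6 is dihedral: in it no involution commutes with
    an element of order 3. The statement describes this in [G], modulo [K]. *)
Lemma order6_quotient (gT : finGroupType) (G K : {group gT}) :
    K <| G -> #|G : K| = 6 -> ~~ abelian (G / K) ->
  exists L : {group gT},
    [/\ K \subset L, L <| G, #|G : L| = 2, #|L : K| = 3
      & {in G :\: L & L, forall t y, [~ y, t] \in K -> y \in K}].
Proof.
move=> nsKG iK nabQ; have [sKG nKG] := andP nsKG.
have oQ: #|G / K| = 6 by rewrite card_quotient.
have [|X QX oX] := @Cauchy _ 3 (G / K)%G isT; first by rewrite /= oQ.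
have /(inv_quotientS nsKG)[L defL sKL sLG]: <[X]> \subset G / K by rewrite cycle_subG.
have nsKL: K <| L := normalS sKL sLG nsKG.
have oLK: #|L / K| = 3 by rewrite -defL -oX.
have iLK: #|L : K| = 3 by rewrite -card_quotient ?normal_norm.
have iGL: #|G : L| = 2.
  by apply/eqP; rewrite -(eqn_pmul2r (isT : 0 < 3)) -{1}iLK Lagrange_index // iK.
exists L; split=> //; first exact: index2_normal.
move=> t y /setDP[Gt nLt] Ly Kyt; apply: contraR nabQ => nKy.
have [Nt Ny] : t \in 'N(K) /\ y \in 'N(K).
  by rewrite !(subsetP nKG) // (subsetP sLG).
have cty: coset K t \in 'C[coset K y].
  apply/cent1P/esym/commgP; rewrite -morphR //=; exact/eqP/coset_id.
have LKy: coset K y \in L / K by apply: mem_quotient.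
have iQ: prime #|G / K : L / K| by rewrite index_quotient_eq ?iGL // subIset ?sKL ?orbT.
have sLC: L / K \subset 'C_(G / K)[coset K y].
  rewrite subsetI quotientS // sub_cent1; apply: (subsetP _ _ LKy).
  by apply/cyclic_abelian/prime_cyclic; rewrite oLK.
have [/= defC | /= defC] := prime_index_between iQ sLC (subsetIl _ _); last first.
  have: coset K t \in 'C_(G / K)[coset K y] by rewrite inE mem_quotient.
  by rewrite defC mem_quotientE // (negPf nLt).
apply: (@cyclic_factor_abelian _ (L / K)); last first.
  apply: prime_cyclic; rewrite card_quotient ?quotient_norms //.
  by rewrite normal_norm // index2_normal.
apply: prime_meetG; rewrite ?oLK //; apply/trivgPn; exists (coset K y).
  rewrite inE LKy inE mem_quotient ?(subsetP sLG) //= -sub_cent1.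
  by rewrite -{1}defC subsetIr.
by apply: contra nKy => /eqP/coset_idr; apply.
Qed.

(** In a nonabelian group of order 6, distinct involutions do not commute. *)
Lemma order6_commute (gT : finGroupType) (G L K : {group gT}) :
    L \subset G -> #|G : L| = 2 ->
    {in G :\: L & L, forall t y, [~ y, t] \in K -> y \in K} ->
  {in G :\: L & G :\: L, forall t u, 'C_G[u] = 'C_G[t] -> t^-1 * u \in K}.
Proof.
move=> sLG iL cLK t u GLt GLu eqC; have [Gu _] := setDP GLu.
have ctu := same_cent_commute Gu eqC.
apply: (cLK t) => //; first exact: index2_div GLt GLu.
suff /commgP/eqP-> : commute (t^-1 * u) t by [].
apply: commute_sym; apply: commuteM; first exact/commuteV.
exact/commute_sym/cent1P.
Qed.

(** No element generates a noncyclic group of order 4. *)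
Lemma klein_adjoin (gT : finGroupType) (G A : {group gT}) x :
    A <| G -> #|G : A| = 4 -> ~~ cyclic (G / A) -> x \in G :\: A ->
  #|G : A <*> <[x]>| = 2 /\ #|A <*> <[x]> : A| = 2.
Proof.
move=> /andP[sAG nAG] iA ncQ /setDP[Gx nAx].
have sMG: A <*> <[x]> \subset G by rewrite join_subG sAG cycle_subG.
have sAM: A \subset A <*> <[x]> := joing_subl _ _.
have: 1 < #|A <*> <[x]> : A|.
  rewrite indexg_gt1; apply: contra nAx => /subsetP; apply.
  by rewrite mem_gen // inE cycle_id orbT.
have: 1 < #|G : A <*> <[x]>|.
  rewrite indexg_gt1; apply: contra ncQ => sGM.
  have nAx' := subsetP nAG x Gx.
  have: G / A \subset <[coset A x]>.
    apply: subset_trans (quotientS A sGM) _.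
    by rewrite quotientYidl ?cycle_subG // quotient_cycle.
  by move/cyclicS; apply; apply: cycle_cyclic.
have := Lagrange_index sMG sAM; rewrite iA.
move: #|G : _| #|_ : A| => i j ij i1 j1.
have i3: i < 3 by rewrite ltnNge; apply/negP=> i3; move: (leq_mul i3 j1); rewrite ij.
have j3: j < 3 by rewrite ltnNge; apply/negP=> j3; move: (leq_mul i1 j3); rewrite ij.
by case: i i1 i3 {ij} => [|[|[|i]]] // _ _; case: j j1 j3 => [|[|[|j]]].
Qed.

(** The intersection has index less than 3 in both conjugates, hence index 2; so it
    is normal in both, and they generate [G]. *)
Lemma index2_conj_inter (gT : finGroupType) (G M : {group gT}) g :
    M \subset G -> #|G : M| = 3 -> g \in G -> M :^ g != M ->
  [/\ M :&: M :^ g <| G, #|M : M :&: M :^ g| = 2 & #|G : M :&: M :^ g| = 6].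
Proof.
move=> sMG iM Gg neqM; pose K := (M :&: M :^ g)%G.
have sKM: K \subset M := subsetIl _ _.
have sMgG: M :^ g \subset G by rewrite conj_subG.
have iK: #|M : K| = 2.
  have := ltn_index_conj_inter sMG Gg neqM; rewrite iM -[M :&: _]/(gval K).
  rewrite -(Lagrange sKM) mulnC ltn_pmul2r ?cardG_gt0 // => lt3.
  apply/eqP; rewrite eqn_leq -ltnS lt3 indexg_gt1.
  apply: contra neqM => sMK; rewrite eq_sym eqEcard cardJg leqnn andbT.
  by apply: subset_trans sMK (subsetIr _ _).
have iKg: #|M :^ g : K| = 2.
  by rewrite -divgS ?subsetIr // cardJg -iK divgS.
split=> //; last by rewrite -(Lagrange_index sMG sKM) iM iK.
rewrite /normal (subset_trans sKM sMG) /=.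
have sJG: M <*> M :^ g \subset G by rewrite join_subG sMG.
have pM: prime #|G : M| by rewrite iM.
have [/= <- | /= eqM] := prime_index_between pM (joing_subl M (M :^ g)) sJG.
  rewrite join_subG !normal_norm //; first exact: (@index2_normal _ (M :^ g) K (subsetIr _ _)).
  exact: (@index2_normal _ M K).
case/eqP: neqM; apply/eqP; rewrite eqEcard cardJg leqnn andbT.
by apply: subset_trans (joing_subr M _) _; rewrite eqM.
Qed.

(** * Abelian subgroups of maximal order *)

(** Maximality refers to the order, which is stronger than maximality for
    inclusion and survives conjugation and passage to a subgroup containing [A]. *)
Definition ab_max (gT : finGroupType) (G A : {group gT}) : Prop :=
  [/\ A \subset G, abelian A &
      forall B : {group gT}, B \subset G -> abelian B -> #|B| <= #|A|].

Lemma ab_max_exists (gT : finGroupType) (G : {group gT}) :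
  exists A : {group gT}, ab_max G A.
Proof.
pose P (B : {group gT}) := (B \subset G) && abelian B.
have P1: P 1%G by rewrite /P sub1G abelian1.
case: (@arg_maxnP _ 1%G P (fun B => #|B|) P1) => A /andP[sAG abA] maxA.
by exists A; split=> // B sBG abB; apply: maxA; rewrite /P sBG.
Qed.

Lemma ab_max_eq (gT : finGroupType) (G A B : {group gT}) :
  ab_max G A -> B \subset G -> abelian B -> #|A| <= #|B| -> ab_max G B.
Proof.
move=> [sAG abA maxA] sBG abB leAB; split=> // C sCG abC.
exact: leq_trans (maxA C sCG abC) leAB.
Qed.

Lemma ab_max_sub (gT : finGroupType) (G M A : {group gT}) :
  ab_max G A -> A \subset M -> M \subset G -> ab_max M A.
Proof.
move=> [_ abA maxA] sAM sMG; split=> // B sBM abB.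
by apply: maxA abB; apply: subset_trans sMG.
Qed.

Lemma ab_max_cent (gT : finGroupType) (G A : {group gT}) :
  ab_max G A -> 'C_G(A) \subset A.
Proof.
move=> [sAG abA maxA]; apply/subsetP=> t /setIP[Gt cAt].
have sAB: A \subset A <*> <[t]> by apply: joing_subl.
have: #|A <*> <[t]>| <= #|A|.
  apply: maxA; first by rewrite join_subG sAG cycle_subG.
  by rewrite abelianY abA cycle_abelian cycle_subG.
rewrite (geq_leqif (subset_leqif_card sAB)) => /subsetP; apply.
by rewrite mem_gen // inE cycle_id orbT.
Qed.

Lemma ab_max_center (gT : finGroupType) (G A : {group gT}) :
  ab_max G A -> 'Z(G) \subset A.
Proof.
move=> maxA; have [sAG _ _] := maxA; apply: subset_trans (ab_max_cent maxA).
by rewrite setIS // centS.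
Qed.

Lemma ab_max_center_proper (gT : finGroupType) (G A : {group gT}) :
  ab_max G A -> ~~ abelian G -> 'Z(G) \proper A.
Proof.
move=> maxA nabG; rewrite properEneq ab_max_center // andbT.
apply: contraNneq nabG => defA; have: 'C_G(A) \subset A := ab_max_cent maxA.
rewrite -defA; have -> : 'C_G('Z(G)) = G by apply/setIidPl; rewrite centsC subsetIr.
by move/abelianS; apply; apply: center_abelian.
Qed.

Lemma sub_cent_of_joing (gT : finGroupType) (A B G : {group gT}) :
  abelian A -> abelian B -> A <*> B = G -> A :&: B \subset 'C(G).
Proof.
move=> abA abB <-; rewrite centY subsetI.
by rewrite (subset_trans (subsetIl A B) abA) (subset_trans (subsetIr A B) abB).
Qed.

(** A central subgroup stays abelian when one element is adjoined; Cauchy's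
    theorem in the quotient provides an element of order [p]. *)
Lemma central_cauchy (gT : finGroupType) (G D : {group gT}) p :
    prime p -> D \subset 'Z(G) -> p %| #|G : D| ->
  exists B : {group gT}, [/\ B \subset G, abelian B & #|B| = (p * #|D|)%N].
Proof.
move=> p_pr sDZ pGD; have nsDG: D <| G := sub_center_normal sDZ.
rewrite -card_quotient ?normal_norm // in pGD.
have [X GX oX] := Cauchy p_pr pGD.
have /inv_quotientS[|B defB sDB sBG]: <[X]> \subset G / D by rewrite cycle_subG.
  by [].
have nsDB: D <| B by apply: normalS nsDG.
exists B; split=> //; last first.
  by rewrite -(Lagrange sDB) -card_quotient ?normal_norm // -defB mulnC -oX.
apply: (@cyclic_factor_abelian _ D); last by rewrite -defB cycle_cyclic.
rewrite subsetI sDB; apply: subset_trans (centS sBG).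
by have /subsetIP[] := sDZ.
Qed.

(** This turns a prime divisor of the index of a central subgroup into a lower
    bound for the order of [A], and is the main source of contradictions. *)
Lemma ab_max_cauchy (gT : finGroupType) (G A D : {group gT}) p :
  ab_max G A -> prime p -> D \subset 'Z(G) -> p %| #|G : D| -> p * #|D| <= #|A|.
Proof.
move=> [_ _ maxA] p_pr sDZ pGD.
by have [B [sBG abB <-]] := central_cauchy p_pr sDZ pGD; apply: maxA.
Qed.

Lemma ab_max_not_centralised (gT : finGroupType) (G A : {group gT}) t :
  ab_max G A -> t \in G :\: A -> ~~ (A \subset 'C[t]).
Proof.
move=> maxA /setDP[Gt nAt]; apply: contra nAt; rewrite sub_cent1 => cAt.
by apply: (subsetP (ab_max_cent maxA)); rewrite inE Gt.
Qed.

Lemma ab_max_cent1_half (gT : finGroupType) (G A : {group gT}) t :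
  ab_max G A -> t \in G :\: A -> 2 * #|'C_A[t]| <= #|A|.
Proof.
move=> maxA GAt; apply: leq_double_proper; first exact: subsetIl.
by rewrite subsetI subxx (ab_max_not_centralised maxA).
Qed.

Lemma ab_max_cent1_neq (gT : finGroupType) (G A : {group gT}) t a :
  ab_max G A -> t \in G :\: A -> a \in A -> 'C_G[t] != 'C_G[a].
Proof.
move=> maxA GAt Aa; have [sAG abA _] := maxA.
apply: contra (ab_max_not_centralised maxA GAt) => /eqP eqC.
suff: A \subset 'C_G[t] by rewrite subsetI => /andP[].
by rewrite eqC subsetI sAG sub_cent1 (subsetP abA).
Qed.

(** Otherwise [A] and a conjugate [A ^ g] generate [G], so their intersection is
    central. As [A * A ^ g] is not all of [G], this gives [#|A| < p * #|Z(G)|] for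
    the index [p] of [A], whereas an element of order [p] modulo the centre yields
    an abelian subgroup of order [p * #|Z(G)|]. *)
Lemma ab_max_prime_index_normal (gT : finGroupType) (G A : {group gT}) :
  ab_max G A -> prime #|G : A| -> A <| G.
Proof.
move=> maxA p_pr; have [sAG abA _] := maxA; have sZA := ab_max_center maxA.
rewrite /normal sAG; apply: contraLR (leqnn #|A|) => /subsetPn[g Gg].
rewrite inE -ltnNge => nsAg.
have neqA: A :^ g != A.
  by apply: contra nsAg => /eqP->.
have defG: A <*> A :^ g = G.
  have sJG: A <*> A :^ g \subset G by rewrite join_subG sAG conj_subG.
  have [// | eqA] := prime_index_between p_pr (joing_subl A (A :^ g)) sJG.
  case/negP: nsAg; apply: subset_trans (joing_subr A (A :^ g)) _.
  by move: eqA => /= ->.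
have sIZ: A :&: A :^ g \subset 'Z(G).
  rewrite subsetI (subset_trans (subsetIl _ _) sAG).
  by apply: sub_cent_of_joing => //; rewrite abelianJ.
apply: leq_trans (ltn_index_conj_inter sAG Gg neqA) _.
apply: leq_trans (ab_max_cauchy maxA p_pr (subxx 'Z(G)) _); last first.
  by rewrite -(Lagrange_index sAG sZA) dvdn_mulr.
by rewrite leq_mul2l subset_leq_card ?orbT.
Qed.

(** Two such subgroups of prime index [p] generate [M], so they meet in the centre
    of [M], and [M / Z(M)] has order [p ^ 2]. *)
Lemma ab_max_center_normals (gT : finGroupType) (M A B : {group gT}) :
    ab_max M A -> ab_max M B -> prime #|M : A| -> A != B :> {set gT} ->
  [/\ A :&: B = 'Z(M), A * B = M, #|A| = (#|M : A| * #|'Z(M)|)%N,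
      #|M : 'Z(M)| = (#|M : A| ^ 2)%N & abelian (M / 'Z(M))].
Proof.
move=> maxA maxB p_pr neqAB; have nsAM := ab_max_prime_index_normal maxA p_pr.
have [[sAM abA maxA'] [sBM abB maxB']] := (maxA, maxB).
have eqAB: #|A| = #|B| by apply/eqP; rewrite eqn_leq maxA' ?maxB'.
have sJM: A <*> B \subset M by rewrite join_subG sAM.
have defM: A <*> B = M.
  have [// | /= eqA] := prime_index_between p_pr (joing_subl A B) sJM.
  case/eqP: neqAB; apply/esym/eqP; rewrite eqEcard eqAB leqnn andbT.
  by apply: subset_trans (joing_subr A B) _; rewrite eqA.
have defZ: A :&: B = 'Z(M).
  apply/eqP; rewrite eqEsubset; apply/andP; split; last first.
    by rewrite subsetI !ab_max_center.
  rewrite subsetI (subset_trans (subsetIl A B) sAM) /=.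
  exact: sub_cent_of_joing.
have defAB: A * B = M.
  by rewrite -norm_joinEr // (subset_trans sBM (normal_norm nsAM)).
have oA: #|A| = (#|M : A| * #|'Z(M)|)%N.
  apply/eqP; rewrite -(eqn_pmul2l (cardG_gt0 A)) mulnA Lagrange //.
  by rewrite -defZ -defAB -mul_cardG eqAB.
have iZ: #|M : 'Z(M)| = (#|M : A| ^ 2)%N.
  rewrite -(Lagrange_index sAM (ab_max_center maxA)) expnS expn1; congr (_ * _)%N.
  apply/eqP; rewrite -(eqn_pmul2l (cardG_gt0 'Z(M))) Lagrange ?ab_max_center //.
  by rewrite oA mulnC.
split=> //; have oQ: #|M / 'Z(M)| = (#|M : A| ^ 2)%N.
  by rewrite card_quotient // normal_norm ?center_normal.
apply: (@p2group_abelian _ #|M : A|); rewrite /pgroup oQ ?pnatX ?pnat_id //.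
by rewrite pfactorK.
Qed.

(** Adjoining to [Z(M)] any element of [M] outside it gives an abelian subgroup of order at least
    that of [A]. Since [M / Z(M)] is abelian, it is normal in [M], and one further
    element [g] normalising it makes it normal in [G]. *)
Lemma ab_max_center_adjoin (gT : finGroupType) (G M A : {group gT}) p w g :
    ab_max G A -> M <| G -> prime #|G : M| -> prime p ->
    #|A| = (p * #|'Z(M)|)%N -> #|M : 'Z(M)| = (p ^ 2)%N -> abelian (M / 'Z(M)) ->
    w \in M -> w \notin 'Z(M) -> g \in G -> g \notin M ->
    w ^ g \in 'Z(M) <*> <[w]> ->
  ab_max G ('Z(M) <*> <[w]>) /\ 'Z(M) <*> <[w]> <| G.
Proof.
move=> maxA nsMG q_pr p_pr oA iZ abQ Mw nZw Gg nMg Twg; have sMG := normal_sub nsMG.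
have nsZG: 'Z(M) <| G := gFnormal_trans _ nsMG.
have sM'Z: M^`(1) \subset 'Z(M) by rewrite der1_min // normal_norm ?center_normal.
pose T := ('Z(M) <*> <[w]>)%G.
have sTM: T \subset M by rewrite join_subG center_sub cycle_subG.
have abT: abelian T.
  rewrite abelianY center_abelian cycle_abelian cycle_subG /=.
  by apply: (subsetP _ w Mw); rewrite centsC subsetIr.
have sZT: 'Z(M) \subset T by apply: joing_subl.
have leAT: #|A| <= #|T|.
  have: #|T : 'Z(M)| %| p ^ 2.
    by rewrite -iZ -(Lagrange_index sTM sZT) dvdn_mull.
  case/dvdn_pfactor=> // -[|m] _ iT.
    have sTZ: T \subset 'Z(M) by rewrite -indexg_eq1 iT.
    by case/negP: nZw; rewrite (subsetP sTZ) // mem_gen // inE cycle_id orbT.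
  rewrite -(Lagrange sZT) iT oA mulnC leq_pmul2l // expnS leq_pmulr //.
  by rewrite expn_gt0 prime_gt0.
split; first by apply: (@ab_max_eq _ G A T) => //; apply: subset_trans sTM sMG.
rewrite /normal (subset_trans sTM) //.
rewrite -(prime_index_adjoin q_pr sMG Gg nMg) join_subG cycle_subG.
rewrite (sub_der1_norm (subset_trans sM'Z sZT)) //=.
rewrite inE conjYg -cycleJ (normP (subsetP (normal_norm nsZG) g Gg)).
by rewrite join_subG joing_subl cycle_subG.
Qed.

(** If [A] is not normal then an element [g] outside [M] moves it. For [x] in [A]
    outside [Z(M)], the subgroup generated by [Z(M)] and [x * x ^ g] replaces [A]. *)
Lemma ab_max_index2_normal (gT : finGroupType) (G M A : {group gT}) :
    ab_max G A -> A \subset M -> M \subset G -> #|G : M| = 2 -> prime #|M : A| ->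
  exists2 T : {group gT}, ab_max G T & T <| G.
Proof.
move=> maxA sAM sMG iM p_pr; have [sAG abA maxA'] := maxA.
have maxAM := ab_max_sub maxA sAM sMG.
have nsAM := ab_max_prime_index_normal maxAM p_pr.
have nsMG: M <| G := index2_normal sMG iM.
have [nsAG | ] := boolP (A <| G); first by exists A.
rewrite /normal sAG => /subsetPn[g Gg nAg].
have Mg: g \notin M by apply: contra nAg; apply/subsetP/normal_norm.
have neqA: A != A :^ g :> {set gT} by apply: contra nAg => /eqP eqA; rewrite inE -eqA.
have sAgM: A :^ g \subset M by rewrite -(normP (subsetP (normal_norm nsMG) g Gg)) conjSg.
have maxAg: ab_max M (A :^ g)%G.
  by apply: ab_max_eq maxAM _ _ _; rewrite ?abelianJ ?cardJg.
have [defZ defM oA iZ abQ] := ab_max_center_normals maxAM maxAg p_pr neqA.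
have nsZG: 'Z(M) <| G := gFnormal_trans _ nsMG.
have sM'Z: M^`(1) \subset 'Z(M) by rewrite der1_min // normal_norm ?center_normal.
have [x Ax nZx]: exists2 x, x \in A & x \notin 'Z(M).
  apply/subsetPn; apply: contraL (prime_gt1 p_pr) => /subset_leq_card.
  by rewrite oA -leqNgt -{2}(mul1n #|'Z(M)|) leq_pmul2r ?cardG_gt0.
have Mx := subsetP sAM x Ax.
(* modulo Z(M) the element w is fixed by g, since g ^+ 2 lies in M and M / Z(M)
   is abelian *)
pose w := x * x ^ g.
have Mw: w \in M by rewrite groupM // (subsetP sAgM) ?memJ_conjg.
have nZw: w \notin 'Z(M).
  apply: contra nZx => Zw.
  have Zxg: x ^ g \in 'Z(M).
    rewrite -defZ inE memJ_conjg Ax andbT -(groupMl _ Ax).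
    by apply: subsetP Zw; rewrite ab_max_center.
  by rewrite -(memJ_norm x (subsetP (normal_norm nsZG) g Gg)).
have sZT: 'Z(M) \subset 'Z(M) <*> <[w]> by apply: joing_subl.
have Mgg: g ^+ 2 \in M by rewrite -iM expg_index.
have Mxg: x ^ g \in M by rewrite (subsetP sAgM) ?memJ_conjg.
suff wg_T: w ^ g \in 'Z(M) <*> <[w]>.
  have [] := ab_max_center_adjoin maxA nsMG _ p_pr oA iZ abQ Mw nZw Gg Mg wg_T.
    by rewrite iM.
  by exists ('Z(M) <*> <[w]>)%G.
(* w ^ g is w times two commutators of elements of M *)
have ->: w ^ g = w * ([~ x ^ g, x] * [~ x, g ^+ 2]).
  rewrite /w conjMg -conjgM -expg2 (conjg_mulR x (g ^+ 2)) 2!mulgA.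
  by rewrite [x ^ g * x]commgC -!mulgA.
have Tw: w \in 'Z(M) <*> <[w]> by rewrite mem_gen // inE cycle_id orbT.
by rewrite (groupM Tw) // groupM // (subsetP (subset_trans sM'Z sZT)) ?mem_commg.
Qed.

(** * Non-normal abelian subgroups that are maximal subgroups *)

Lemma maximal_abelian_conjI (gT : finGroupType) (G A : {group gT}) g :
    maximal_eq A G -> abelian A -> g \in G -> A :^ g != A ->
  A :&: A :^ g \subset 'Z(G).
Proof.
move=> /maximal_eqP[sAG maxA] abA Gg neqA.
rewrite subsetI (subset_trans (subsetIl A _) sAG) /=.
apply: (sub_cent_of_joing (B := (A :^ g)%G)); rewrite ?abelianJ //.
have sJG: A <*> A :^ g \subset G by rewrite join_subG sAG conj_subG.
have [/= eqA | //] := maxA _ (joing_subl A (A :^ g)) sJG.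
case/eqP: neqA; apply/eqP; rewrite eqEcard cardJg leqnn andbT.
by apply: subset_trans (joing_subr A _) _; rewrite eqA.
Qed.

Lemma maximal_abelian_norm (gT : finGroupType) (G A : {group gT}) :
  maximal_eq A G -> ~~ (A <| G) -> 'N_G(A) = A.
Proof.
move=> /maximal_eqP[sAG maxA]; rewrite /normal sAG /= => nnA.
have sAN: A \subset 'N_G(A) by rewrite subsetI sAG normG.
have [//|/= eqN] := maxA _ sAN (subsetIl G 'N(A)).
by case/negP: nnA; rewrite -eqN subsetIr.
Qed.

Lemma maximal_abelian_cent1 (gT : finGroupType) (G A : {group gT}) a :
    maximal_eq A G -> abelian A -> a \in A -> a \notin 'Z(G) -> 'C_G[a] = A.
Proof.
move=> /maximal_eqP[sAG maxA] abA Aa nZa.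
have sAC: A \subset 'C_G[a] by rewrite subsetI sAG sub_cent1 (subsetP abA).
have [//|/= eqC] := maxA _ sAC (subsetIl G 'C[a]).
by case/negP: nZa; rewrite inE (subsetP sAG) //= -sub_cent1 -{1}eqC subsetIr.
Qed.

(** Distinct conjugates of [A] meet in the centre, and [A] is its own normaliser. *)
Lemma maximal_abelian_Frobenius (gT : finGroupType) (G A : {group gT}) :
    ab_max G A -> maximal_eq A G -> ~~ (A <| G) ->
  [Frobenius G / 'Z(G) with complement A / 'Z(G)].
Proof.
move=> maxA mA nnA; have [sAG abA _] := maxA; have sZA := ab_max_center maxA.
have nsZG: 'Z(G) <| G := center_normal G.
have nsZA: 'Z(G) <| A := normalS sZA sAG nsZG.
have defN := maximal_abelian_norm mA nnA.
apply/andP; split.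
  apply: contra nnA => /eqP eqQ; suff -> : A :=: G by [].
  by apply: (quotient_inj nsZA nsZG).
apply/normedTI_memJ_P; split; rewrite ?quotientS //.
  rewrite setD_eq0 subG1 -subG1 quotient_sub1 ?normal_norm //.
  apply: contra nnA => sAZ; suff -> : A :=: 'Z(G) by [].
  by apply/eqP; rewrite eqEsubset sAZ.
move=> b _ /setD1P[ntb /morphimP[a Na Aa defb]] /morphimP[g Ng Gg ->].
rewrite {b}defb in ntb *.
rewrite -morphJ // in_setD1.
have nZa: a \notin 'Z(G) by apply: contra ntb => Za; apply/eqP/coset_id.
have nZag: a ^ g \notin 'Z(G) by rewrite memJ_norm.
have liftA u: u \in 'N('Z(G)) -> (coset 'Z(G) u \in A / 'Z(G)) = (u \in A).
  exact: mem_quotientE.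
have -> : coset_morphism 'Z(G) (a ^ g) != 1.
  by apply: contra nZag => /eqP/coset_idr; apply; rewrite (groupJ Na Ng).
rewrite /= !liftA ?(groupJ Na Ng) //; apply/idP/idP => [Aag | Ag]; last by rewrite (groupJ Aa Ag).
apply: contraR nZag => nAg.
have neqA: A :^ g != A.
  apply: contra nAg => /eqP eqA; suff: g \in 'N_G(A) by rewrite defN.
  by rewrite inE Gg inE eqA subxx.
apply: (subsetP (maximal_abelian_conjI mA abA Gg neqA)).
by rewrite inE Aag memJ_conjg.
Qed.

Lemma card_normal_Sylow3_order6 (gT : finGroupType) (K : {group gT}) :
  #|K| = 6 -> #|'O_3(K)| = 3.
Proof.
move=> oK; have: #|'Syl_3(K)| == 1%N.
  have := card_Syl_mod K (isT : prime 3); have := card_Syl_dvd 3 K.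
  rewrite oK; move: #|_| => n dvd_n; have := dvdn_leq (isT : 0 < 6) dvd_n.
  by case: n dvd_n => [|[|[|[|[|[|[|n]]]]]]].
case/normal_sylowP=> P sylP nsPK.
by rewrite (normal_Hall_pcore sylP nsPK) (card_Hall sylP) oK p_part.
Qed.

(** Otherwise [G / Z(G)] is a Frobenius group with complement [A / Z(G)] and a
    kernel [K] of order 4 or 6. In the first case the elements over [K] have at most
    4 centralizers, and all others have one of the 4 conjugates of [A] as their
    centralizer, which makes at most 8. In the second case the complement has
    order 5, and it would act without fixed points on a Sylow subgroup of order 3. *)
Lemma nine_cent_maximal_normal (gT : finGroupType) (G A : {group gT}) :
    ab_max G A -> maximal_eq A G -> #|G : A| = 4 \/ #|G : A| = 6 ->
  n_centralizer 9 G -> A <| G.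
Proof.
move=> maxA mA iA n9; have [sAG abA _] := maxA; have sZA := ab_max_center maxA.
have nsZG: 'Z(G) <| G := center_normal G.
apply: contraT => nnA; have frobC := maximal_abelian_Frobenius maxA mA nnA.
have [K frobK] := Frobenius_kernel_exists frobC.
have [defQ ntK ntH prK prH] := Frobenius_context frobK.
have iHQ: #|G / 'Z(G) : A / 'Z(G)| = #|G : A|.
  by apply: index_quotient_eq; rewrite ?normal_norm // subIset ?sZA ?orbT.
have [_ sHQ _ nKH _] := sdprod_context defQ.
have oK: #|K| = #|G : A|.
  by rewrite -iHQ -divgS // -(sdprod_card defQ) mulnK.
have dvdH := Frobenius_dvd_ker1 frobK; rewrite oK in dvdH.
have {}iA: #|G : A| = 4.
  case: iA => // iA; rewrite iA in oK dvdH.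
  have oH: #|A / 'Z(G)| = 5.
    have [_ /(_ _ dvdH)/orP[|/eqP //]] := primeP (isT : prime 5).
    by rewrite -trivg_card1 (negPf ntH).
  have oP := card_normal_Sylow3_order6 oK.
  have nPH: A / 'Z(G) \subset 'N('O_3(K)) by apply: gFnorm_trans.
  have: semiregular 'O_3(K) (A / 'Z(G)).
    move=> x Hx; apply/trivgP; rewrite -(Frobenius_reg_ker frobK Hx).
    by rewrite setSI ?pcore_sub.
  by move/(regular_norm_dvd_pred nPH); rewrite oP oH.
have [L defK sZL sLG] := inv_quotientS nsZG (proper_sub prK).
have cover_G: G \subset L :|: [set x in G | 'C_G[x] \in A :^: G].
  apply/subsetP=> x Gx; rewrite !inE Gx /=.
  have Nx: x \in 'N('Z(G)) by apply: (subsetP (normal_norm nsZG)).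
  have /and3P[/eqP defP _ _] := Frobenius_partition frobK.
  have: coset 'Z(G) x \in cover (gval K |: ((A / 'Z(G))^# :^: K)).
    by rewrite defP mem_quotient.
  case/bigcupP=> _ /setU1P[->|/imsetP[k Kk ->]] => [Kx | Akx].
    rewrite -(quotientGK (normalS sZL sLG nsZG)) -defK; apply/orP; left.
    exact: mem_morphpre.
  have /morphimP[g Ng Gg defk] : k \in G / 'Z(G) := subsetP (proper_sub prK) k Kk.
  have nsZA : 'Z(G) <| A := normalS sZA sAG nsZG.
  have Ng' : g^-1 \in 'N('Z(G)) by rewrite groupV.
  rewrite mem_conjg defk -morphV // -morphJ //= in Akx.
  have [nt_a] := setD1P Akx; rewrite mem_quotientE ?(groupJ Nx Ng') // => Aa.
  have nZa: x ^ g^-1 \notin 'Z(G) by apply: contra nt_a => Za; apply/eqP/coset_id.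
  apply/orP; right; rewrite -(conjgKV g x) cent1_conj //.
  by rewrite (maximal_abelian_cent1 mA) // imset_f.
have: ncent G G <= 8.
  apply: leq_trans (ncentS _ cover_G) _; apply: leq_trans (ncentU_le _ _ _) _.
  rewrite (_ : 8 = 4 + 4)%N // leq_add //.
    have := leq_ncent_lcoset L (group1 G) (subxx 'Z(G)); rewrite mul1g => /leq_trans; apply.
    rewrite -card_quotient ?(subset_trans sLG (normal_norm nsZG)) //.
    by rewrite -defK oK iA.
  rewrite -iA -[X in #|_ : X|](maximal_abelian_norm mA nnA) -card_conjugates.
  apply/subset_leq_card/subsetP=> C /imsetP[x]; rewrite inE => /andP[_ AGx] ->.
  exact: AGx.
by rewrite [ncent _ _]n9.
Qed.

(** * A normal abelian subgroup of index at most seven *)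

(** Suppose that no such subgroup exists. If [A] has two conjugates then [M / Z(M)]
    has order 4. Either [Z(M)] is the centre of [G], and an element of order 3 modulo
    it contradicts the maximality of [A], or some [b] in [Z(M)] is not central. In the
    latter case an element [t] outside [M] centralises no element of [M] outside
    [Z(M)], which otherwise would generate with [Z(M)] a suitable subgroup. So
    [C_M(t)] is central and the elements outside [M] have at least 8 centralizers;
    those of [b] and of [1] are two more. *)
Lemma ab_max_index3_normal (gT : finGroupType) (G M A : {group gT}) :
    ab_max G A -> A \subset M -> M <| G -> #|G : M| = 3 -> #|M : A| = 2 ->
    n_centralizer 9 G ->
  exists2 T : {group gT}, ab_max G T & T <| G.
Proof.
move=> maxA sAM nsMG iM iA n9; have [sAG abA maxA'] := maxA.
have sMG := normal_sub nsMG; have maxAM := ab_max_sub maxA sAM sMG.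
have pM: prime #|G : M| by rewrite iM.
have [nsAG | ] := boolP (A <| G); first by exists A.
rewrite /normal sAG => /subsetPn[g Gg nAg].
have neqA: A != A :^ g :> {set gT} by apply: contra nAg => /eqP eqA; rewrite inE -eqA.
have sAgM: A :^ g \subset M by rewrite -(normP (subsetP (normal_norm nsMG) g Gg)) conjSg.
have maxAg: ab_max M (A :^ g)%G.
  by apply: ab_max_eq maxAM _ _ _; rewrite ?abelianJ ?cardJg.
have pA: prime #|M : A| by rewrite iA.
have [defZ defM oA iZ abQ] := ab_max_center_normals maxAM maxAg pA neqA.
rewrite {}iA in oA iZ pA; set D := 'Z(M) in defZ oA iZ abQ.
have sDM: D \subset M := center_sub M.
have sZD: 'Z(G) \subset D.
  rewrite subsetI (subset_trans (ab_max_center maxA) sAM).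
  by rewrite (subset_trans (subsetIr _ _)) ?centS.
have sZM := subset_trans sZD sDM.
have [b Db nZb]: exists2 b, b \in D & b \notin 'Z(G).
  apply/subsetPn/negP => sDZ.
  have: 3 * #|'Z(G)| <= #|A|.
    apply: ab_max_cauchy maxA _ _ _ => //.
    by rewrite -(Lagrange_index sMG sZM) iM dvdn_mulr.
  apply/negP; rewrite oA -ltnNge.
  apply: leq_ltn_trans (leq_mul (leqnn 2) (subset_leq_card sDZ)) _.
  by rewrite ltn_pmul2r ?cardG_gt0.
have defMt t : t \in G :\: M -> M <*> <[t]> = G.
  by case/setDP=> Gt nMt; apply: prime_index_adjoin.
have cDt t : t \in G :\: M -> 'C_D[t] \subset 'Z(G).
  move=> GMt; apply/subsetP=> c /setIP[/centerP[Mc cMc] ctc].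
  apply/setIP; split; first exact: (subsetP sMG).
  rewrite -(defMt t GMt) centY inE cent_cycle ctc andbT.
  by apply/centP=> x Mx; apply: cMc.
have [cMD | ] := boolP [forall t in G :\: M, 'C_M[t] \subset D]; last first.
  rewrite negb_forall_in => /exists_inP[t /setDP[Gt nMt] /subsetPn[c /setIP[Mc ctc] nDc]].
  have cT: c ^ t \in D <*> <[c]>.
    by rewrite /conjg (cent1P ctc) mulKg mem_gen // inE cycle_id orbT.
  have [] := ab_max_center_adjoin maxA nsMG pM pA oA iZ abQ Mc nDc Gt nMt cT.
  by exists (D <*> <[c]>)%G.
have cMZ: {in G :\: M, forall t, 'C_M[t] \subset 'Z(G)}.
  move=> t GMt; apply: subset_trans (cDt t GMt); rewrite subsetI subsetIr andbT.
  by have /forall_inP/(_ t GMt) := cMD.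
have neqb: {in G :\: M, forall t, 'C_G[t] != 'C_G[b]}.
  move=> t GMt; apply: contra nZb => /eqP eqC; apply: (subsetP (cMZ t GMt)).
  have Mb := subsetP sDM b Db; rewrite inE Mb /=.
  by apply: same_cent_commute (esym eqC); apply: (subsetP sMG).
have neq1: {in G :\: M :|: [set b], forall t, 'C_G[t] != 'C_G[1]}.
  move=> t /setUP[/setDP[Gt nMt] | /set1P->]; apply: cent1_noncentral => //.
    by apply: contra nMt; apply: (subsetP sZM).
  by rewrite (subsetP sMG) // (subsetP sDM).
have: ncent G (G :\: M :|: [set b] :|: [set 1]) <= 9.
  rewrite -n9; apply: ncentS; rewrite !subUset subsetDl !sub1set group1.
  by rewrite (subsetP sMG) // (subsetP sDM).
rewrite !ncent_add // 2!ltnS leqNgt; case/negP.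
have prM : M \proper G by rewrite properE sMG -indexg_eq1 iM.
apply: leq_trans (leq_ncent_setD (subxx G) nsMG prM (subxx _) sZM cMZ).
rewrite -(Lagrange_index sDM sZD) iZ (leq_mul2l 4 2) /= indexg_gt1.
by apply/subsetPn; exists b.
Qed.

(** Let [K] be the core of [M], so that [G / K] is dihedral of order 6, and let
    [E] be the intersection of [A] and [K]; it has index 2 in [K]. If [K] is abelian
    then it is the required subgroup. Otherwise the centre of [K] is that of [G].
    If [E] is normal then [E] has index 6 in its centralizer, and an element of order 3
    modulo [E] gives an abelian subgroup larger than [A]. If [E] has another conjugate
    then [K / Z(G)] has order 4 and [A] has order [4 * #|Z(G)|], so that
    [G / Z(G)] resembles the symmetric group of degree 4; with [L / K] of order 3,
    the elements of [L] outside [K] have at least 4 centralizers and the elements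
    outside [L] at least 6 others. *)
Lemma ab_max_index3_nonnormal (gT : finGroupType) (G M A : {group gT}) :
    ab_max G A -> A \subset M -> M \subset G -> ~~ (M <| G) ->
    #|G : M| = 3 -> #|M : A| = 2 -> n_centralizer 9 G ->
  exists2 T : {group gT}, ab_max G T & T <| G.
Proof.
move=> maxA sAM sMG nnM iM iA n9; have [sAG abA maxA'] := maxA.
have pM: prime #|G : M| by rewrite iM.
have [g Gg neqM]: exists2 g, g \in G & M :^ g != M.
  move: nnM; rewrite /normal sMG => /subsetPn[g Gg nMg]; exists g => //.
  by apply: contra nMg => /eqP eqM; rewrite inE eqM.
have [] := index2_conj_inter sMG iM Gg neqM.
pose K := (M :&: M :^ g)%G; rewrite -[M :&: _]/(gval K) => nsKG iMK iK.
have sKM: K \subset M := subsetIl _ _.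
have sKG := normal_sub nsKG.
have oKA: #|K| = #|A|.
  by apply/eqP; rewrite -(eqn_pmul2r (isT : 0 < 2)) -{1}iMK -iA !Lagrange.
have [abK | nabK] := boolP (abelian K).
  by exists K => //; apply: ab_max_eq maxA _ _ _; rewrite ?oKA.
have nabQ: ~~ abelian (G / K).
  apply: contra nnM => abQ; apply: sub_der1_normal sMG.
  by apply: subset_trans sKM; rewrite der1_min ?normal_norm.
have [L [sKL nsLG iL iLK cLK]] := order6_quotient nsKG iK nabQ.
have nsAM : A <| M := index2_normal sAM iA.
have nAK: ~~ (K \subset A).
  by apply: contra nabK => sKA; apply: abelianS abA.
have pA: prime #|M : A| by rewrite iA.
have defM: A * K = M.
  rewrite -norm_joinEr ?(subset_trans sKM (normal_norm nsAM)) //.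
  have sJM: A <*> K \subset M by rewrite join_subG sAM.
  have [//|/= eqA] := prime_index_between pA (joing_subl A K) sJM.
  by case/negP: nAK; apply: subset_trans (joing_subr A K) _; rewrite eqA.
pose E := (A :&: K)%G.
have sEA: E \subset A := subsetIl _ _.
have sEK: E \subset K := subsetIr _ _.
have abE: abelian E := abelianS sEA abA.
have oA: #|A| = (2 * #|E|)%N.
  apply/eqP; rewrite -(eqn_pmul2r (cardG_gt0 K)) mul_cardG defM mulnAC.
  by rewrite eqn_pmul2r ?cardG_gt0 // -(Lagrange sKM) iMK mulnC.
have iKE: #|K : E| = 2 by rewrite -divgS // oKA oA mulnK ?cardG_gt0.
have pE: prime #|K : E| by rewrite iKE.
have defCE: 'C_K(E) = E.
  have sEC: E \subset 'C_K(E) by rewrite subsetI sEK.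
  have [/= defC|//] := prime_index_between pE sEC (subsetIl _ _).
  case/negP: nabK; apply: (@cyclic_factor_abelian _ E).
    by rewrite subsetI sEK centsC; apply/setIidPl.
  by apply: prime_cyclic; rewrite card_quotient // normal_norm // index2_normal.
have sZKE: 'Z(K) \subset E by rewrite -defCE setIS // centS.
have nsZKG: 'Z(K) <| G := gFnormal_trans _ nsKG.
have sZKZ: 'Z(K) \subset 'Z(G).
  rewrite subsetI (normal_sub nsZKG) centsC.
  have sMC: M \subset 'C_G('Z(K)).
    rewrite -defM mul_subG // subsetI.
      by rewrite sAG centsC (subset_trans sZKE) // (subset_trans sEA).
    by rewrite sKG centsC subsetIr.
  have [/= <-|/= eqC] := prime_index_between pM sMC (subsetIl _ _).
    exact: subsetIr.
  case/negP: nnM; rewrite /normal sMG -eqC normsI ?normG // norms_cent //.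
  exact: normal_norm.
have sZA := ab_max_center maxA.
have sZK: 'Z(G) \subset K.
  rewrite subsetI (subset_trans sZA sAM) /=.
  rewrite -(normP (subsetP (normal_norm (center_normal G)) g Gg)) conjSg.
  exact: subset_trans sZA sAM.
have defZ: 'Z(K) = 'Z(G).
  apply/eqP; rewrite eqEsubset sZKZ subsetI sZK.
  by rewrite (subset_trans (subsetIr _ _)) ?centS.
have [nsEG | nnE] := boolP (E <| G).
  pose C := 'C_G(E)%G.
  have sAC: A \subset C by rewrite subsetI sAG centsC (subset_trans sEA).
  have nsCG: C <| G.
    by rewrite /normal subsetIl normsI ?normG ?norms_cent // normal_norm.
  have CK_G: C * K = G.
    rewrite -norm_joinEr ?(subset_trans sKG (normal_norm nsCG)) //.
    have sMJ: M \subset C <*> K.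
      by rewrite -defM mul_subG ?joing_subr // (subset_trans sAC) ?joing_subl.
    have sJG: C <*> K \subset G by rewrite join_subG sKG subsetIl.
    have [//|eqJ] := prime_index_between pM sMJ sJG.
    case/negP: nnM; rewrite -eqJ; exact: normalY.
  have iCE: #|C : E| = 6.
    have sEC: E \subset C := subset_trans sEA sAC.
    have CIK: C :&: K = E by rewrite /= setIAC (setIidPr sKG).
    have := mul_cardG C K; rewrite CK_G CIK -(Lagrange sEC) -(Lagrange sKG) iK.
    rewrite mulnAC [(#|K| * 6 * _)%N]mulnAC [(#|K| * #|E|)%N]mulnC => /eqP.
    by rewrite eqn_pmul2l ?muln_gt0 ?cardG_gt0 // => /eqP.
  have: 3 * #|E| <= #|A|.
    apply: ab_max_cauchy (ab_max_sub maxA sAC (subsetIl _ _)) _ _ _ => //.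
      by rewrite subsetI (subset_trans sEA sAC) centsC subsetIr.
    by rewrite iCE.
  by rewrite oA leq_pmul2r ?cardG_gt0.
have [h Gh nEh]: exists2 h, h \in G & E :^ h != E.
  move: nnE; rewrite /normal (subset_trans sEA sAG) => /subsetPn[h Gh nMh].
  by exists h => //; apply: contra nMh => /eqP eqE; rewrite inE eqE.
have maxE: ab_max K E.
  split=> // B sBK abB.
  have nBK: #|K : B| != 1%N.
    by rewrite indexg_eq1; apply: contra nabK => sKB; apply: abelianS abB.
  rewrite -(leq_pmul2l (isT : 0 < 2)) -{2}iKE [X in _ <= X]mulnC Lagrange //.
  rewrite -(Lagrange sBK) mulnC leq_mul //.
  by case: #|K : B| (indexg_gt0 K B) nBK => [|[]].
have maxEh: ab_max K (E :^ h)%G.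
  apply: ab_max_eq maxE _ _ _; rewrite ?abelianJ ?cardJg //.
  by rewrite -(normP (subsetP (normal_norm nsKG) h Gh)) conjSg.
have [_ _ oE iZ _] : [/\ E :&: (E :^ h) = 'Z(K), E * (E :^ h) = K,
    #|E| = (2 * #|'Z(K)|)%N, #|K : 'Z(K)| = 4%N & abelian (K / 'Z(K))].
  have := ab_max_center_normals maxE maxEh pE; rewrite iKE; apply.
  by rewrite eq_sym.
rewrite defZ in oE iZ.
have pLK: prime #|L : K| by rewrite iLK.
have sLG := normal_sub nsLG.
have cyK: {in L :\: K, forall y, 'C_K[y] \subset 'Z(G)}.
  move=> y /setDP[Ly nKy]; apply/subsetP=> c /setIP[Kc cyc].
  apply: contraT => nZc.
  have Gc := subsetP sKG c Kc; have Gy := subsetP sLG y Ly.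
  have cZ x : x \in G -> 'Z(G) \subset 'C[x].
    by move=> Gx; rewrite sub_cent1 (subsetP _ x Gx) // centsC subsetIr.
  pose B := ('Z(G) <*> <[c]>)%G; pose B2 := (B <*> <[y]>)%G.
  have abB: abelian B.
    by rewrite abelianY center_abelian cycle_abelian cycle_subG -sub_cent1 cZ.
  have abB2: abelian B2.
    rewrite abelianY abB cycle_abelian cycle_subG -sub_cent1 join_subG cZ //=.
    by rewrite cycle_subG.
  have sBK: B \subset K by rewrite join_subG sZK cycle_subG.
  have sB2L: B2 \subset L by rewrite join_subG (subset_trans sBK) ?cycle_subG.
  have sKJ: K \subset B2 <*> K by apply: joing_subr.
  have sJL: B2 <*> K \subset L by rewrite join_subG sB2L.
  have B2K: B2 * K = L.
    rewrite -norm_joinEl; last first.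
      by apply: subset_trans sB2L (subset_trans sLG (normal_norm nsKG)).
    have [//|/= eqJ] := prime_index_between pLK sKJ sJL.
    case/negP: nKy; suff: y \in B2 <*> K by rewrite eqJ.
    by rewrite !mem_gen // !inE mem_gen ?orbT // !inE cycle_id orbT.
  have leB: 2 * #|'Z(G)| <= #|B|.
    have sZB: 'Z(G) \subset B by apply: joing_subl.
    rewrite -(Lagrange sZB) mulnC leq_pmul2l ?cardG_gt0 // indexg_gt1.
    apply: contra nZc => /subsetP; apply.
    by rewrite mem_gen // inE cycle_id orbT.
  have leB2: #|B2| <= #|A| by apply: maxA'; rewrite ?(subset_trans sB2L).
  have: 3 * #|B| <= #|B2|.
    rewrite -(leq_pmul2r (cardG_gt0 K)) mul_cardG B2K -(Lagrange sKL) iLK.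
    rewrite mulnC mulnA leq_mul // subset_leq_card // subsetI sBK joing_subl //.
  move/(leq_trans (leq_mul (leqnn 3) leB))/leq_trans/(_ leB2).
  by rewrite oA oE !mulnA leq_pmul2r ?cardG_gt0.
have ctK: {in G :\: L, forall t, #|'C_K[t]| <= 2 * #|'Z(G)|}.
  move=> t /setDP[Gt nLt].
  have nKC: ~~ (K \subset 'C_K[t]).
    apply/negP; rewrite subsetI subxx /= sub_cent1 => cKt.
    have [y Ly nKy]: exists2 y, y \in L & y \notin K.
      by apply/subsetPn; rewrite -indexg_eq1 iLK.
    have nsCG: 'C_G(K) <| G by rewrite /normal subsetIl normsI ?normG ?norms_cent // normal_norm.
    have Gy := subsetP sLG y Ly.
    have Lc: [~ y, t] \in L by rewrite groupM ?groupV // memJ_norm ?(subsetP (normal_norm nsLG)).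
    have nKc: [~ y, t] \notin K by apply: contra nKy; apply: cLK; rewrite // inE nLt.
    have Cc: [~ y, t] \in 'C_G(K).
      have Ct: t \in 'C_G(K) by rewrite inE Gt.
      rewrite commgEr groupM // memJ_norm ?groupV // (subsetP (normal_norm nsCG)) //.
    have sKZ: K \subset 'Z(G).
      apply: subset_trans (cyK [~ y, t] _); last by rewrite inE nKc.
      by rewrite subsetI subxx sub_cent1; case/setIP: Cc.
    by case/negP: nabK; apply: abelianS sKZ (center_abelian G).
  have sCK: 'C_K[t] \subset K := subsetIl _ _.
  rewrite -(leq_pmul2l (isT : 0 < 2)) mulnA -{1}[(2 * 2)%N]iZ.
  rewrite [X in _ <= X]mulnC Lagrange // -(Lagrange sCK) mulnC leq_pmul2l //.
  by rewrite indexg_gt1.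
have n1: 4 <= ncent G (L :\: K).
  rewrite -iZ; apply: leq_ncent_setD => //.
  - exact: normalS nsKG.
  - by rewrite properE sKL -indexg_eq1 iLK.
have n2: 6 <= ncent G (G :\: L).
  have := leq_ncent_cosets (subsetDl _ _) (order6_commute sLG iL cLK) ctK.
  rewrite cardsD (setIidPr sLG) -(Lagrange sLG) iL muln2 -addnn addnK.
  rewrite -(Lagrange sKL) iLK -(Lagrange sZK) iZ -mulnA mulnC mulnA.
  by rewrite leq_pmul2r ?cardG_gt0 // -[(4 * 3)%N]/(6 * 2)%N leq_pmul2r.
have: ncent G (L :\: K :|: G :\: L) <= 9.
  by rewrite -n9; apply: ncentS; rewrite subUset subsetDl subDset subsetU ?sLG ?orbT.
rewrite ncentU; first by move/(leq_trans (leq_add n1 n2)).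
move=> t u LKt GLu; apply/eqP=> eqC; have [Lt nKt] := setDP LKt.
case/negP: nKt; apply: (cLK u) => //.
suff /commgP/eqP-> : commute t u by [].
by apply/cent1P; apply: same_cent_commute eqC; apply: (subsetP sLG).
Qed.

(** A noncentral [x] lies in the centre of its centralizer, which is abelian and
    depends on the centralizer only. So the noncentral elements are covered by 8
    sets with at most [#|A| - #|Z(G)|] elements. *)
Lemma nine_cent_ab_max_index (gT : finGroupType) (G A : {group gT}) :
  ab_max G A -> n_centralizer 9 G -> #|G : A| <= 7.
Proof.
move=> maxA n9; have [sAG abA maxA'] := maxA; have sZA := ab_max_center maxA.
have fib: {in G :\: 'Z(G), forall t,
    #|[set u in G :\: 'Z(G) | 'C_G[u] == 'C_G[t]]| <= #|A| - #|'Z(G)|}.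
  move=> t /setDP[Gt _]; pose B := 'Z('C_G[t])%G.
  have sBC: B \subset 'C_G[t] := center_sub _.
  have sZB: 'Z(G) \subset B.
    have sZC: 'Z(G) \subset 'C_G[t].
      by rewrite subsetI center_sub sub_cent1 (subsetP _ t Gt) // centsC subsetIr.
    by rewrite [B : {set _}]/= subsetI sZC (subset_trans (subsetIr G _)) ?centS ?subsetIl.
  have leB: #|B| <= #|A|.
    by apply: maxA'; rewrite ?center_abelian ?(subset_trans sBC) ?subsetIl.
  
  apply: leq_trans (leq_sub2r _ leB); rewrite -{2}(setIidPr sZB) -cardsD.
  apply/subset_leq_card/subsetP=> u; rewrite inE => /andP[/setDP[Gu nZu] /eqP eqC].
  rewrite in_setD nZu; apply/setIP; rewrite -sub_cent1 /= -eqC subsetIr; split=> //.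
  by apply/setIP; rewrite cent1id.
have n8: ncent G (G :\: 'Z(G)) <= 8.
  rewrite -ltnS -(ncent_add (x := 1)); last first.
    by move=> u /setDP[Gu nZu]; apply: cent1_noncentral.
  by rewrite -[9]n9; apply: ncentS; rewrite subUset subsetDl sub1set group1.
have := leq_card_fibres fib; rewrite cardsD (setIidPr (center_sub G)).
move/leq_trans/(_ (leq_mul n8 (leqnn _))) => le8.
rewrite leqNgt; apply: contraL le8 => lt7; rewrite -ltnNge -(Lagrange sAG).
have := cardG_gt0 'Z(G); have := subset_leq_card sZA.
rewrite mulnBr [(#|A| * _)%N]mulnC; move: #|'Z(G)| #|A| #|_ : _| lt7 => z a m lt7 leza z_gt0.
have le8: 8 * a <= m * a by rewrite leq_mul2r lt7 orbT.
move: (m * a)%N le8 => ma; lia.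
Qed.

Lemma nine_cent_nonabelian (gT : finGroupType) (G : {group gT}) :
  n_centralizer 9 G -> ~~ abelian G.
Proof.
move=> n9; apply/negP => /center_idP defZ.
have := leq_ncent_lcoset G (group1 G) (subxx 'Z(G)).
by rewrite mul1g [ncent G G]n9 /= defZ indexgg.
Qed.

(** Only the indices 4 and 6 are not prime; then [A] is a maximal subgroup or has a
    maximal subgroup [M] above it, of index 2 or 3. *)
Lemma nine_cent_normal_ab_max (gT : finGroupType) (G : {group gT}) :
    n_centralizer 9 G ->
  exists T : {group gT}, [/\ ab_max G T, T <| G & 1 < #|G : T| <= 7].
Proof.
move=> n9; have [A maxA] := ab_max_exists G.
have idx B: ab_max G B -> 1 < #|G : B| <= 7.
  move=> maxB; rewrite nine_cent_ab_max_index // andbT indexg_gt1.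
  have [_ abB _] := maxB; apply: contra (nine_cent_nonabelian n9) => sGB.
  exact: abelianS abB.
suff [T maxT nsTG]: exists2 T : {group gT}, ab_max G T & T <| G.
  by exists T; split; rewrite ?idx.
have := idx A maxA; have [sAG abA _] := maxA.
have [pA _ | npA idxA] := boolP (prime #|G : A|).
  by exists A; rewrite ?ab_max_prime_index_normal.
have i46: #|G : A| = 4 \/ #|G : A| = 6.
  move: npA idxA; case: #|_ : _| => [|[|[|[|[|[|[|[|n]]]]]]]] //; first by left.
  by right.
have [mA | nmA] := boolP (maximal_eq A G).
  by exists A; rewrite ?nine_cent_maximal_normal.
have [defA | [M maxM sAM]] := maximal_exists sAG.
  by rewrite defA indexgg in idxA.
have sMG := proper_sub (maxgroupp maxM).
have iMA: 1 < #|M : A|.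
  rewrite indexg_gt1; apply: contra nmA => sMA.
  have -> : A :=: M by apply/eqP; rewrite eqEsubset sAM.
  by rewrite /maximal_eq maxM orbT.
have iGM: 1 < #|G : M| by rewrite indexg_gt1 (proper_subn (maxgroupp maxM)).
have eqi := Lagrange_index sMG sAM.
have [[iM2 pA] | [iM3 iA2]] : #|G : M| = 2 /\ prime #|M : A| \/ #|G : M| = 3 /\ #|M : A| = 2.
  move: eqi iMA iGM i46; move: #|G : M| #|M : A| #|G : A| => i j k <- j1 i1 ij.
  have i3: i <= 3.
    by rewrite leqNgt; apply/negP=> i4; move: (leq_mul i4 j1); case: ij => ->.
  have j3: j <= 3.
    by rewrite leqNgt; apply/negP=> j4; move: (leq_mul i1 j4); case: ij => ->.
  case: i i1 i3 ij => [|[|[|[|i]]]] // _ _; case: j j1 j3 => [|[|[|[|j]]]] // _ _.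
  - by left.
  - by left.
  - by right.
  - by case.
  exact: ab_max_index2_normal maxA sAM sMG iM2 pA.
have [nsMG | nnM] := boolP (M <| G).
  exact: ab_max_index3_normal maxA sAM nsMG iM3 iA2 n9.
exact: ab_max_index3_nonnormal maxA sAM sMG nnM iM3 iA2 n9.
Qed.

(** * Non-cyclic quotients by an abelian subgroup *)

(** Each element outside [A] centralises at most half of [A]. *)
Lemma double_leq_ncent (gT : finGroupType) (G A : {group gT}) (S : {set gT}) n :
    ab_max G A -> S \subset G :\: A ->
    {in S & S, forall t u, 'C_G[u] = 'C_G[t] -> t^-1 * u \in A} ->
    #|S| = (n * #|A|)%N ->
  2 * n <= ncent G S.
Proof.
move=> maxA sSGA divS oS.
have sSG: S \subset G := subset_trans sSGA (subsetDl _ _).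
have cA: {in S, forall t, #|'C_A[t]| <= #|A| %/ 2}.
  move=> t St; rewrite leq_divRL // mulnC.
  by apply: ab_max_cent1_half (maxA) _; apply: (subsetP sSGA).
have := leq_ncent_cosets sSG divS cA; rewrite oS => le.
rewrite -(leq_pmul2r (cardG_gt0 A)) -mulnA.
apply: leq_trans (leq_mul (leqnn 2) le) _.
by rewrite mulnCA leq_mul2l mulnC leq_trunc_div orbT.
Qed.

(** Some [b] in [C_A(t)] is not central, and some [a] in [A] does not commute
    with [t]. The coset of [u] has at least 4 centralizers, because [Z(G)] is strictly
    inside [C_A(t)], which is strictly inside [A]. The coset of [t] has at least 3:
    at least [#|A : C_A(t)|], and one more because [u] separates the centralizers of
    [t] and [t * b]. The other three are those of [a], [b] and [1]. *)
Lemma ncent_commuting_pair (gT : finGroupType) (G A : {group gT}) t u :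
    ab_max G A -> t \in G :\: A -> u \in G :\: A -> u \in 'C[t] ->
    'C_A[u] \subset 'Z(G) -> ~~ ('C_A[t] \subset 'Z(G)) ->
  10 <= ncent G G.
Proof.
move=> maxA GAt GAu ctu cuZ /subsetPn[b /setIP[Ab ctb] nZb].
have [sAG abA _] := maxA; have sZA := ab_max_center maxA.
have [[Gt nAt] [Gu nAu]] := (setDP GAt, setDP GAu).
have [a Aa nca]: exists2 a, a \in A & a \notin 'C[t].
  exact/subsetPn/(ab_max_not_centralised maxA).
have coset_G x : x \in G -> x *: A \subset G.
  by move=> Gx; rewrite mul_subG ?sub1set.
have coset_nA x y : x \in G :\: A -> y \in x *: A -> y \in G :\: A.
  case/setDP=> Gx nAx /lcosetP[c Ac ->]; rewrite inE groupMr // nAx.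
  by rewrite groupM // (subsetP sAG).
have coset_div x : {in x *: A & x *: A, forall v w, 'C_G[w] = 'C_G[v] -> v^-1 * w \in A}.
  move=> _ _ /lcosetP[c Ac ->] /lcosetP[d Ad ->] _.
  by rewrite invMg -mulgA mulKg groupM ?groupV.
have coset_C x y : y \in x *: A -> 'C_A[y] = 'C_A[x].
  by case/lcosetP=> c Ac ->; apply: cent1_lcoset.
have n1: 2 < ncent G (t *: A).
  have: #|t *: A| < ncent G (t *: A) * #|'C_A[t]|.
    apply: (@ltn_ncent_cosets _ G A (t *: A) _ t b) => //.
    - exact: coset_G.
    - by move=> y /coset_C->.
    - exact: lcoset_refl.
    - by rewrite inE Ab.
    apply: contra nZb => /eqP eqC; apply: (subsetP cuZ); rewrite inE Ab cent1C.
    have: u \in 'C_G[t * b] by rewrite eqC inE Gu.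
    by rewrite inE Gu /= ![u \in _]cent1C groupMl // cent1C.
  rewrite card_lcoset => lt; rewrite -(ltn_pmul2r (cardG_gt0 'C_A[t])).
  exact: leq_ltn_trans (ab_max_cent1_half maxA GAt) lt.
have n2: 4 <= ncent G (u *: A).
  have: #|u *: A| <= ncent G (u *: A) * #|'Z(G)|.
    apply: (@leq_ncent_cosets _ G A (u *: A)) => //; first exact: coset_G.
    by move=> y /coset_C->; apply: subset_leq_card.
  rewrite card_lcoset => le; rewrite -(leq_pmul2r (cardG_gt0 'Z(G))).
  apply: leq_trans le; apply: leq_trans (ab_max_cent1_half maxA GAt).
  rewrite -[4]/(2 * 2)%N -mulnA leq_pmul2l //; apply: leq_double_proper.
    by rewrite subsetI sZA sub_center_cent1.
  by apply/subsetPn; exists b; rewrite // inE Ab.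
have tuA x: x \in t *: A :|: u *: A -> x \in G :\: A.
  by case/setUP; apply: coset_nA.
have sZA' := subsetP sZA.
have: ncent G (t *: A :|: u *: A :|: [set b] :|: [set a] :|: [set 1]) <= ncent G G.
  apply: ncentS; rewrite !subUset !sub1set !coset_G //= group1.
  by rewrite !(subsetP sAG).
rewrite !ncent_add.
- rewrite ncentU; first by apply: leq_trans; rewrite !ltnS (leq_add n1 n2).
  move=> x v tAx uAv; apply: contra nZb => /eqP eqC; apply: (subsetP cuZ).
  rewrite -(coset_C _ _ uAv) -(setIidPl sAG) -setIA -eqC setIA (setIidPl sAG).
  by rewrite (coset_C _ _ tAx) inE Ab.
- by move=> x /tuA/ab_max_cent1_neq; apply.
- move=> x /setUP[/tuA/ab_max_cent1_neq | /set1P->]; first exact.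
  apply: contra nca => /eqP eqC; rewrite cent1C.
  have: t \in 'C_G[b] by rewrite inE Gt cent1C.
  by rewrite eqC => /setIP[].
move=> x /setUP[/setUP[/tuA/setDP[Gx nAx] | /set1P->] | /set1P->].
- by apply: cent1_noncentral => //; apply: contra nAx; apply: sZA'.
- exact: cent1_noncentral (subsetP sAG b Ab) nZb.
apply: cent1_noncentral (subsetP sAG a Aa) _.
by apply: contra nca; apply/subsetP/sub_center_cent1.
Qed.

(** Let [L / A] be the subgroup of order 3. If the elements outside [L] centralise
    only [Z(G)] in [A], they have at least 9 centralizers. Otherwise they still have
    at least 6, and some noncentral [b] in [A] commutes with such an element; the
    centralizers of [b], of a conjugate of [b], of an element of [L] outside [A] and
    of [1] are four more. *)
Lemma order6_nonabelian_ncent (gT : finGroupType) (G A : {group gT}) :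
    ab_max G A -> A <| G -> #|G : A| = 6 -> ~~ abelian (G / A) ->
  10 <= ncent G G.
Proof.
move=> maxA nsAG iA nabQ; have [sAG abA _] := maxA; have sZA := ab_max_center maxA.
have [L [sAL nsLG iL iLA cLA]] := order6_quotient nsAG iA nabQ.
have sLG := normal_sub nsLG.
have sS: G :\: L \subset G :\: A by apply: setDS.
have divS := order6_commute sLG iL cLA.
have oS: #|G :\: L| = (3 * #|A|)%N.
  rewrite cardsD (setIidPr sLG) -(Lagrange sLG) iL muln2 -addnn addnK.
  by rewrite -(Lagrange sAL) iLA mulnC.
have [cZ | ] := boolP [forall t in G :\: L, 'C_A[t] \subset 'Z(G)].
  have le3: #|G :\: L| <= ncent G (G :\: L) * #|'Z(G)|.
    apply: leq_ncent_cosets divS _; first exact: subsetDl.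
    by move=> t GLt; apply/subset_leq_card/(forall_inP cZ).
  have le6: 3 * #|'Z(G)| <= #|A|.
    apply: ab_max_cauchy maxA _ _ _ => //.
    by rewrite -(Lagrange_index sAG sZA) iA dvdn_mulr.
  have n9: 9 <= ncent G (G :\: L).
    rewrite -(leq_pmul2r (cardG_gt0 'Z(G))); apply: leq_trans le3.
    by rewrite oS -[9]/(3 * 3)%N -mulnA leq_pmul2l.
  apply: (@leq_trans (ncent G (G :\: L :|: [set 1]))).
    by rewrite ncent_add // => t /(subsetP sS)/ab_max_cent1_neq; apply.
  by apply: ncentS; rewrite subUset subsetDl sub1set group1.
rewrite negb_forall_in => /exists_inP[t GLt /subsetPn[b /setIP[Ab ctb] nZb]].
have n6 := double_leq_ncent maxA sS divS oS.
have [Gt nLt] := setDP GLt.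
have [y Ly nAy]: exists2 y, y \in L & y \notin A.
  by apply/subsetPn; rewrite -indexg_eq1 iLA.
have Gy := subsetP sLG y Ly; have Gb := subsetP sAG b Ab.
have Aby: b ^ y \in A by rewrite memJ_norm // (subsetP (normal_norm nsAG)).
have pLA: prime #|L : A| by rewrite iLA.
have pGL: prime #|G : L| by rewrite iL.
have sACb: A \subset 'C_G[b] by rewrite subsetI sAG sub_cent1 (subsetP abA).
have CbL: 'C_G[b] :&: L \subset A.
  apply/subsetP=> x /setIP[/setIP[Gx cbx] Lx]; apply: contraR nZb => nAx.
  apply/setIP; split=> //; rewrite -sub_cent1.
  rewrite -(prime_index_adjoin pGL sLG Gt nLt) join_subG cycle_subG [t \in _]cent1C ctb andbT.
  rewrite -(prime_index_adjoin pLA sAL Lx nAx) join_subG cycle_subG cbx andbT.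
  by rewrite sub_cent1 (subsetP abA).
have neqCby: 'C_G[b] != 'C_G[b ^ y].
  apply: contra nAy => /eqP eqC; apply: (cLA t) => //.
  apply: (subsetP CbL); rewrite inE; apply/andP; split; last first.
    by rewrite groupM ?groupV // memJ_norm // (subsetP (normal_norm nsLG)).
  have Cbt: t \in 'C_G[b] by rewrite inE Gt cent1C.
  have Cbty: t^-1 ^ y \in 'C_G[b] by rewrite eqC cent1_conj // memJ_conjg groupV.
  by rewrite commgEr groupM.
have: ncent G (G :\: L :|: [set y] :|: [set b] :|: [set b ^ y] :|: [set 1]) <= ncent G G.
  apply: ncentS; rewrite !subUset !sub1set subsetDl Gy Gb group1 /=.
  by rewrite andbT groupJ.
have GAy : y \in G :\: A by rewrite inE nAy.
have neqA u : u \in G :\: L :|: [set y] -> u \in G :\: A.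
  by case/setUP=> [/(subsetP sS) | /set1P->].
rewrite !ncent_add.
- by apply: leq_trans; rewrite !ltnS.
- move=> u GLu; have [Gu nLu] := setDP GLu; apply: contra nAy => /eqP eqC.
  apply: (cLA u) => //; suff /commgP/eqP-> : commute y u by [].
  exact/cent1P/(same_cent_commute Gy).
- by move=> u /neqA/ab_max_cent1_neq; apply.
- move=> u /setUP[/neqA/ab_max_cent1_neq | /set1P-> //]; exact.
move=> u /setUP[/setUP[/neqA/ab_max_cent1_neq | /set1P->] | /set1P->]; first exact.
  exact: cent1_noncentral.
apply: cent1_noncentral; first exact: groupJ.
by rewrite memJ_norm // (subsetP (normal_norm (center_normal G))).
Qed.

(** Here the elements outside [A] have at least 6 centralizers. With noncentral
    [b] in [C_A(t)] and [c] in [C_A(u)], those of [b], [c], [b * c] and [1] are four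
    more, told apart by [t] and [u]. *)
Lemma klein_ncent_two_cosets (gT : finGroupType) (G A : {group gT}) t u :
    ab_max G A -> A <| G -> #|G : A| = 4 -> ~~ cyclic (G / A) ->
    t \in G :\: A -> u \in G :\: (A <*> <[t]>) ->
    ~~ ('C_A[t] \subset 'Z(G)) -> ~~ ('C_A[u] \subset 'Z(G)) ->
  10 <= ncent G G.
Proof.
move=> maxA nsAG iA ncQ GAt GMu.
move=> /subsetPn[b /setIP[Ab ctb] nZb] /subsetPn[c /setIP[Ac cuc] nZc].
have [sAG abA _] := maxA; have [[Gt nAt] [Gu nMu]] := (setDP GAt, setDP GMu).
have nAu: u \notin A by apply: contra nMu; apply: subsetP; apply: joing_subl.
have sMG x : x \in G -> A <*> <[x]> \subset G.
  by move=> Gx; rewrite join_subG sAG cycle_subG.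
have genG x y : x \in G :\: A -> y \in G :\: A <*> <[x]> -> A <*> <[x]> <*> <[y]> = G.
  move=> GAx /setDP[Gy nMy]; have [iM _] := klein_adjoin nsAG iA ncQ GAx.
  by apply: prime_index_adjoin; rewrite ?iM ?sMG //; case/setDP: GAx.
have centrI x y d : x \in G :\: A -> y \in G :\: A <*> <[x]> ->
    d \in 'C_A[x] -> d \in 'C[y] -> d \in 'Z(G).
  move=> GAx GMy /setIP[Ad cxd] cyd; rewrite inE (subsetP sAG) //=.
  rewrite -(genG x y) // -sub_cent1 !join_subG !cycle_subG ![_ \in 'C[d]]cent1C.
  by rewrite cxd cyd sub_cent1 (subsetP abA).
have adj x : x \in A <*> <[x]> by rewrite mem_gen // inE cycle_id orbT.
have divA x v w : x \in G :\: A -> v \in A <*> <[x]> -> v \notin A ->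
    w \in A <*> <[x]> -> w \notin A -> v^-1 * w \in A.
  move=> GAx Mv nAv Mw nAw; have [_ iM] := klein_adjoin nsAG iA ncQ GAx.
  by apply: (index2_div (joing_subl A <[x]>) iM); rewrite inE ?nAv ?nAw.
have divM x v w : x \in G :\: A -> v \in G :\: A <*> <[x]> ->
    w \in G :\: A <*> <[x]> -> v^-1 * w \in A <*> <[x]>.
  move=> GAx GMv GMw; have [iM _] := klein_adjoin nsAG iA ncQ GAx.
  by case/setDP: GAx => Gx _; apply: index2_div GMv GMw; rewrite ?sMG.
have divS: {in G :\: A & G :\: A, forall x y, 'C_G[y] = 'C_G[x] -> x^-1 * y \in A}.
  move=> x y GAx GAy eqC; have [[Gx nAx] [Gy nAy]] := (setDP GAx, setDP GAy).
  have [Mxy | nMy] := boolP (y \in A <*> <[x]>); first exact: (divA x).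
  have GMy: y \in G :\: A <*> <[x]> by rewrite inE nMy.
  have eqCA: 'C_A[y] = 'C_A[x].
    by rewrite -(setIidPl sAG) -!setIA eqC.
  have cxZ: 'C_A[x] \subset 'Z(G).
    apply/subsetP=> d Cd; apply: (centrI x y) => //.
    by move: Cd; rewrite -eqCA => /setIP[].
  (* x and y centralise only Z(G) in A, so t and u, which centralise more,
     lie in neither of their cosets; a group of order 4 has no room for the
     five distinct cosets of 1, x, y, t and u *)
  have far z d : d \in A -> d \in 'C[z] -> d \notin 'Z(G) ->
      x^-1 * z \notin A /\ z^-1 * y \notin A.
    move=> Ad czd nZd; split; apply: contra nZd => Az; apply: (subsetP cxZ).
      by rewrite -(cent1_lcoset _ abA Az) mulKVg inE Ad.
    rewrite -eqCA -(cent1_lcoset _ abA (groupVr Az)) invMg invgK mulKVg inE Ad //.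
  have [nxt nty] := far t b Ab ctb nZb; have [nxu nuy] := far u c Ac cuc nZc.
  have GMx z : z \in G -> z \notin A -> x^-1 * z \notin A -> z \in G :\: A <*> <[x]>.
    by move=> Gz nAz nxz; rewrite inE Gz andbT; apply: contra nxz => Mz; apply: (divA x).
  have Gtu: t^-1 * u \notin A.
    apply: contra nMu => Atu; rewrite -(mulKVg t u) groupM ?adj //.
    by apply: subsetP Atu; apply: joing_subl.
  case/negP: nuy; have -> : u^-1 * y = (t^-1 * u)^-1 * (t^-1 * y).
    by rewrite invMg invgK -mulgA mulKVg.
  by apply: (divA x) => //; apply: divM => //; apply: GMx.
have oS: #|G :\: A| = (3 * #|A|)%N.
  rewrite cardsD (setIidPr sAG) -(Lagrange sAG) iA mulnS addnC addnK.
  by rewrite mulnC.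
have n6 := double_leq_ncent maxA (subxx _) divS oS.
have GAu: u \in G :\: A by rewrite inE nAu.
have nub: b \notin 'C[u].
  by apply: contra nZb => cub; apply: (centrI t u); rewrite // inE Ab.
have ntc: c \notin 'C[t].
  by apply: contra nZc => ctc; apply: (centrI t u); rewrite // inE Ac.
have: ncent G (G :\: A :|: [set b] :|: [set c] :|: [set b * c] :|: [set 1]) <= ncent G G.
  apply: ncentS; rewrite !subUset !sub1set subsetDl group1 groupM ?(subsetP sAG) //.
rewrite !ncent_add.
- by apply: leq_trans; rewrite !ltnS.
- by move=> x GAx; apply: (ab_max_cent1_neq maxA).
- move=> x /setUP[GAx | /set1P->]; first exact: (ab_max_cent1_neq maxA).
  apply: contra ntc => /eqP eqC; rewrite cent1C.
  by have: t \in 'C_G[b]; [rewrite inE Gt cent1C | rewrite eqC => /setIP[]].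
- move=> x /setUP[/setUP[GAx | /set1P->] | /set1P->].
  + by apply: (ab_max_cent1_neq maxA); rewrite ?groupM.
  + apply: contra ntc => /eqP eqC; have: t \in 'C_G[b] by rewrite inE Gt cent1C.
    by rewrite eqC => /setIP[_]; rewrite cent1C groupMl.
  apply: contra nub => /eqP eqC; have: u \in 'C_G[c] by rewrite inE Gu cent1C.
  by rewrite eqC => /setIP[_]; rewrite cent1C groupMr.
have Z1 x : x \in A -> x \notin 'Z(G) -> 'C_G[x] != 'C_G[1].
  by move=> Ax; apply: cent1_noncentral; apply: (subsetP sAG).
move=> x /setUP[/setUP[/setUP[GAx | /set1P->] | /set1P->] | /set1P->].
- exact: (ab_max_cent1_neq maxA).
- exact: Z1.
- exact: Z1.
apply: Z1; first exact: groupM.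
apply: contra ntc => Zbc; rewrite -(groupMl _ ctb).
by apply: subsetP Zbc; apply: sub_center_cent1.
Qed.

(** By the previous lemma elements outside [M], the group generated by [A] and [t],
    may be assumed to centralise only [Z(G)] in [A]. If one of them commutes with an
    element of [M] outside [A], the count for commuting pairs applies. If not, they
    have at least 8 centralizers, and those of a noncentral element of [A] and of [1]
    are two more. *)
Lemma klein_ncent_noncentral (gT : finGroupType) (G A : {group gT}) t :
    ab_max G A -> A <| G -> #|G : A| = 4 -> ~~ cyclic (G / A) ->
    t \in G :\: A -> ~~ ('C_A[t] \subset 'Z(G)) ->
  10 <= ncent G G.
Proof.
move=> maxA nsAG iA ncQ GAt nCtZ; have [sAG abA _] := maxA; have sZA := ab_max_center maxA.
pose M := (A <*> <[t]>)%G; have [Gt nAt] := setDP GAt.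
have [iM iMA] := klein_adjoin nsAG iA ncQ GAt; rewrite -[A <*> _]/(gval M) in iM iMA.
have sAM: A \subset M := joing_subl _ _.
have sMG: M \subset G by rewrite join_subG sAG cycle_subG.
have [cuZ | ] := boolP [forall u in G :\: M, 'C_A[u] \subset 'Z(G)]; last first.
  rewrite negb_forall_in => /exists_inP[u GMu nCuZ].
  exact: klein_ncent_two_cosets nCtZ nCuZ.
have sSA: G :\: M \subset G :\: A by apply: setDS.
have [/exists_inP[t1 /setDP[Mt1 nAt1] /exists_inP[u GMu cut1]] | nex] :=
    boolP [exists t1 in M :\: A, [exists u in G :\: M, u \in 'C[t1]]].
  have GAt1: t1 \in G :\: A by rewrite inE nAt1 (subsetP sMG).
  apply: (ncent_commuting_pair maxA GAt1 (subsetP sSA u GMu) cut1).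
    exact: (forall_inP cuZ).
  apply: contra nCtZ; rewrite -(cent1_lcoset t abA (a := t^-1 * t1)) ?mulKVg //.
  apply: (index2_div sAM iMA); rewrite inE ?nAt1 // nAt mem_gen // inE.
  by rewrite cycle_id orbT.
have divS: {in G :\: M & G :\: M, forall u v, 'C_G[v] = 'C_G[u] -> u^-1 * v \in A}.
  move=> u v GMu GMv eqC; apply: contraR nex => nAuv.
  apply/exists_inP; exists (u^-1 * v).
    by rewrite inE nAuv; apply: index2_div iM GMu GMv.
  apply/exists_inP; exists u => //; rewrite cent1C groupM ?groupV ?cent1id //.
  by apply: same_cent_commute eqC; case/setDP: GMv.
have n8: 8 <= ncent G (G :\: M).
  have: #|G :\: M| <= ncent G (G :\: M) * #|'Z(G)|.
    apply: leq_ncent_cosets divS _; first exact: subsetDl.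
    by move=> u GMu; apply/subset_leq_card/(forall_inP cuZ).
  rewrite cardsD (setIidPr sMG) -(Lagrange sMG) iM muln2 -addnn addnK.
  rewrite -(Lagrange sAM) iMA mulnC => le2A.
  rewrite -(leq_pmul2r (cardG_gt0 'Z(G))); apply: leq_trans le2A.
  rewrite -[8]/(2 * (2 * 2))%N -!mulnA leq_pmul2l //.
  apply: leq_trans (ab_max_cent1_half maxA GAt); rewrite leq_pmul2l //.
  apply: leq_double_proper => //.
  by rewrite subsetI sZA sub_center_cent1.
have [b /setIP[Ab _] nZb] := subsetPn nCtZ.
have: ncent G (G :\: M :|: [set b] :|: [set 1]) <= ncent G G.
  by apply: ncentS; rewrite !subUset !sub1set subsetDl group1 (subsetP sAG).
rewrite !ncent_add.
- by apply: leq_trans; rewrite !ltnS.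
- by move=> u /(subsetP sSA) GAu; apply: (ab_max_cent1_neq maxA).
move=> u /setUP[/(subsetP sSA) GAu | /set1P->]; first exact: (ab_max_cent1_neq maxA).
by apply: cent1_noncentral => //; apply: (subsetP sAG).
Qed.

(** Under the last hypothesis every noncentral element of [A] has centralizer [A]. *)
Lemma ncent_setD (gT : finGroupType) (G A : {group gT}) :
    A \subset G -> abelian A -> 'Z(G) \proper A ->
    {in G :\: A, forall t, 'C_A[t] \subset 'Z(G)} ->
  ncent G G = (ncent G (G :\: A)).+2.
Proof.
move=> sAG abA /properP[sZA [a Aa nZa]] cAZ.
have sACb b : b \in A -> A \subset 'C_G[b].
  by move=> Ab; rewrite subsetI sAG sub_cent1 (subsetP abA).
have defCb b : b \in A -> b \notin 'Z(G) -> 'C_G[b] = A.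
  move=> Ab nZb; apply/eqP; rewrite eqEsubset sACb // andbT.
  apply/subsetP=> t /setIP[Gt cbt]; apply: contraR nZb => nAt.
  by apply: (subsetP (cAZ t _)); rewrite inE ?nAt // Ab cent1C.
have neqA t b : t \in G :\: A -> b \in A -> 'C_G[t] != 'C_G[b].
  move=> GAt Ab; apply: contra nZa => /eqP eqC; apply: (subsetP (cAZ t GAt)).
  rewrite inE Aa; have: a \in 'C_G[t] by rewrite eqC (subsetP (sACb b Ab)).
  by case/setIP.
have neq1: 'C_G[a] != 'C_G[1] by apply: cent1_noncentral => //; apply: (subsetP sAG).
have <- : ncent G (G :\: A :|: [set a] :|: [set 1]) = (ncent G (G :\: A)).+2.
  rewrite ncent_add; first rewrite ncent_add //.
    by move=> u GAu; apply: neqA.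
  by move=> u /setUP[GAu | /set1P->] //; apply: neqA.
apply/eqP; rewrite eqn_leq; apply/andP; split; last first.
  by apply: ncentS; rewrite !subUset !sub1set subsetDl (subsetP sAG) // group1.
apply/subset_leq_card/subsetP=> _ /imsetP[x Gx ->].
have [nAx | Ax] := boolP (x \in A); last first.
  by apply: imset_f; rewrite !in_setU in_setD Ax Gx.
have [Zx | nZx] := boolP (x \in 'Z(G)).
  have ->: 'C_G[x] = 'C_G[1]; last by apply: imset_f; rewrite !in_setU set11 !orbT.
  apply/eqP; rewrite eqEsubset; apply/andP; split.
    by rewrite subsetI subsetIl sub_cent1 group1.
  rewrite subsetI subsetIl (subset_trans (subsetIl _ _)) // sub_cent1.
  by case/setIP: Zx.
rewrite defCb // -(defCb a) //; apply: imset_f.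
by rewrite !in_setU set11 !orbT.
Qed.

(** For [x] outside [A] the element [a * a ^ x] of [A] commutes with [x], so it is
    central and [x] inverts [a] modulo [Z(G)]. Applied to two elements and to their
    product, this shows that [a] is its own inverse modulo [Z(G)]. *)
Lemma klein_square_central (gT : finGroupType) (G A : {group gT}) :
    A <| G -> abelian A -> #|G : A| = 4 -> ~~ cyclic (G / A) ->
    {in G :\: A, forall t, 'C_A[t] \subset 'Z(G)} ->
  {in A, forall a, a ^+ 2 \in 'Z(G)}.
Proof.
move=> nsAG abA iA ncQ cAZ a Aa; have [sAG nAG] := andP nsAG.
have [t Gt nAt]: exists2 t, t \in G & t \notin A by apply/subsetPn; rewrite -indexg_eq1 iA.
have GAt: t \in G :\: A by rewrite inE nAt.
have [iM iMA] := klein_adjoin nsAG iA ncQ GAt.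
have [u Gu nMu]: exists2 u, u \in G & u \notin A <*> <[t]>.
  by apply/subsetPn; rewrite -indexg_eq1 iM.
have nAu: u \notin A by apply: contra nMu; apply: subsetP; apply: joing_subl.
have nAtu: t * u \notin A.
  apply: contra nMu => Atu; rewrite -(mulKg t u) groupM ?groupV //.
    by rewrite mem_gen // inE cycle_id orbT.
  by apply: subsetP Atu; apply: joing_subl.
have inv x : x \in G -> x \notin A -> a * a ^ x \in 'Z(G).
  move=> Gx nAx; have GAx: x \in G :\: A by rewrite inE nAx.
  have [_ iMx] := klein_adjoin nsAG iA ncQ GAx.
  have Aax: a ^ x \in A by rewrite memJ_norm // (subsetP nAG).
  apply: (subsetP (cAZ x GAx)); rewrite inE groupM //=.
  have Ax2: x ^+ 2 \in A.
    rewrite -iMx; apply: expg_index; last by rewrite mem_gen // inE cycle_id orbT.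
    by apply: index2_normal; rewrite ?joing_subl.
  apply/cent1P/commgP/conjg_fixP; rewrite conjMg -conjgM -expg2.
  have ->: a ^ (x ^+ 2) = a by apply/conjg_fixP/commgP/(centsP abA).
  exact: (centsP abA).
have Aax x : x \in G -> a ^ x \in A by move=> Gx; rewrite memJ_norm // (subsetP nAG).
have Zt := inv t Gt nAt; rewrite -(groupMr _ Zt).
have defZt: a * a ^ t = a ^ u * a ^ (t * u).
  rewrite conjgM -conjMg; apply/esym/conjg_fixP/commgP/cent1P.
  exact: (subsetP (sub_center_cent1 Gu)).
have -> : a ^+ 2 * (a * a ^ t) = (a * a ^ u) * (a * a ^ (t * u)).
  have: a * a ^ u = a ^ u * a by apply: (centsP abA); rewrite ?Aax.
  rewrite defZt; move: (a ^ u) (a ^ (t * u)) => x y cax.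
  by rewrite expg2 -!mulgA [x * (a * y)]mulgA -cax -!mulgA.
by rewrite groupM // inv // groupM.
Qed.

Lemma klein_cent1_abelian (gT : finGroupType) (G A : {group gT}) t :
    A <| G -> #|G : A| = 4 -> 'Z(G) \subset A ->
    t \in G :\: A -> 'C_A[t] \subset 'Z(G) ->
  abelian 'C_G[t] /\ 2 %| #|'C_G[t] : 'Z(G)|.
Proof.
move=> /andP[sAG nAG] iA sZA /setDP[Gt nAt] cAZ.
have sZC: 'Z(G) \subset 'C_G[t] by rewrite subsetI center_sub sub_center_cent1.
have CIA: 'C_G[t] :&: A = 'Z(G).
  apply/eqP; rewrite eqEsubset subsetI sZC sZA andbT.
  by rewrite andbT setIAC (setIidPr sAG).
have: #|'C_G[t] : 'Z(G)| %| 4.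
  rewrite -CIA indexgI -iA -!card_quotient ?(subset_trans _ nAG) ?subsetIl //.
  by rewrite cardSg // quotientS // subsetIl.
pose T := ('Z(G) <*> <[t]>)%G.
have sTC: T \subset 'C_G[t].
  by rewrite join_subG sZC cycle_subG inE Gt cent1id.
have sZT: 'Z(G) \subset T := joing_subl _ _.
have iT: 1 < #|T : 'Z(G)|.
  rewrite indexg_gt1; apply: contra nAt => /subsetP sTZ; apply: (subsetP sZA).
  by apply: sTZ; rewrite mem_gen // inE cycle_id orbT.
have cCT: T \subset 'Z('C_G[t]).
  rewrite subsetI sTC join_subG cycle_subG -sub_cent1 subsetIr andbT.
  by rewrite (subset_trans (subsetIr G _)) // centS // subsetIl.
rewrite -(Lagrange_index sTC sZT) => d4; split; last first.
  move: d4 iT; move: #|_ : T| #|_ : 'Z(G)| => i j d4 j1.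
  have: 1 < i * j.
    by case: i d4 => [|i] d4; [rewrite mul0n in d4 | apply: leq_trans j1 (leq_pmull _ _)].
  by have := dvdn_leq (isT : 0 < 4) d4; case: (i * j)%N d4 => [|[|[|[|[]]]]].
apply: (cyclic_factor_abelian cCT).
have oCT: #|'C_G[t] / T| = #|'C_G[t] : T|.
  by rewrite card_quotient // normal_norm // sub_center_normal.
have: #|'C_G[t] : T| <= 2.
  rewrite -(leq_pmul2r (isT : 0 < 2)); apply: leq_trans (dvdn_leq _ d4) => //.
  by rewrite leq_mul2l iT orbT.
rewrite leq_eqVlt => /orP[/eqP i2 | i1]; first by apply: prime_cyclic; rewrite oCT i2.
have -> : 'C_G[t] / T = 1 :> {set coset_of T}; last exact: cyclic1.
by apply: card1_trivg; apply/eqP; rewrite eqn_leq cardG_gt0 andbT oCT -ltnS.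
Qed.

(** Outside [A] the elements with a given centralizer [C] are those of [C] outside
    [Z(G)], and [C] has even index over [Z(G)]. Summing over these centralizers [C],
    their number has the parity of [#|G :\: A| / #|Z(G)|], which is even since
    [A / Z(G)] has exponent 2. *)
Lemma klein_ncent_even (gT : finGroupType) (G A : {group gT}) :
    A <| G -> abelian A -> #|G : A| = 4 -> ~~ cyclic (G / A) ->
    'Z(G) \proper A -> {in G :\: A, forall t, 'C_A[t] \subset 'Z(G)} ->
  2 %| ncent G G.
Proof.
move=> nsAG abA iA ncQ ltZA cAZ; have sAG := normal_sub nsAG.
have sZA := proper_sub ltZA.
rewrite (ncent_setD sAG abA ltZA cAZ) -(addn2 (ncent _ _)) dvdn_addl //.
have Cab t (GAt : t \in G :\: A) := klein_cent1_abelian nsAG iA sZA GAt (cAZ t GAt).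
have even_iA: 2 %| #|A : 'Z(G)|.
  have [_ [a Aa nZa]] := properP ltZA.
  have Na := subsetP (normal_norm (center_normal G)) a (subsetP sAG a Aa).
  have sAN: A \subset 'N('Z(G)) := subset_trans sAG (normal_norm (center_normal G)).
  rewrite -card_quotient //; have <-: #[coset 'Z(G) a] = 2.
    apply: nt_prime_order => //.
      rewrite -morphX //; apply: coset_id.
      by apply: klein_square_central Aa.
    by apply: contra nZa => /eqP/coset_idr; apply.
  by rewrite order_dvdG ?mem_quotient.
set X := [set 'C_G[x] | x in G :\: A].
have fibE: {in X, forall C, #|[set u in G :\: A | 'C_G[u] == C]| + #|'Z(G)| = #|C|}.
  move=> _ /imsetP[t GAt ->]; have [abC _] := Cab t GAt.
  have [Gt nAt] := setDP GAt.
  have sZC: 'Z(G) \subset 'C_G[t] by rewrite subsetI center_sub sub_center_cent1.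
  rewrite -[#|'C_G[t]|](cardsID 'Z(G)) (setIidPr sZC) addnC; congr (_ + _)%N.
  apply: eq_card => u; rewrite !in_setD inE.
  apply/idP/idP => [/andP[/setDP[Gu nAu] /eqP eqC] | /andP[nZu /setIP[Gu cut]]].
    rewrite in_setI Gu (same_cent_commute Gu eqC) !andbT.
    by apply: contra nAu; apply: subsetP.
  have nAu: u \notin A.
    by apply: contra nZu => Au; apply: (subsetP (cAZ t GAt)); rewrite inE Au.
  have GAu: u \in G :\: A by rewrite inE nAu.
  by rewrite GAu (cent1_eq_abelian Gt Gu abC (proj1 (Cab u GAu)) cut) eqxx.
have dvdS: 2 * #|'Z(G)| %| #|G :\: A|.
  rewrite cardsD (setIidPr sAG) -(Lagrange sAG) iA mulnS addnC addnK.
  by rewrite -(Lagrange sZA) dvdn_mulr // mulnC dvdn_pmul2l ?cardG_gt0.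
have: 2 * #|'Z(G)| %| #|G :\: A| + #|X| * #|'Z(G)|.
  rewrite (card_imset_fibres (fun x => 'C_G[x]) (G :\: A)) -sum_nat_const -big_split /=.
  apply: dvdn_sum => C XC; rewrite fibE //.
  have /imsetP[t GAt ->] := XC; have [_ d2] := Cab t GAt; have [Gt _] := setDP GAt.
  have sZC: 'Z(G) \subset 'C_G[t] by rewrite subsetI center_sub sub_center_cent1.
  by rewrite -(Lagrange sZC) mulnC dvdn_pmul2l ?cardG_gt0.
by rewrite dvdn_addr // dvdn_pmul2r ?cardG_gt0.
Qed.

Lemma nine_cent_index4_cyclic (gT : finGroupType) (G A : {group gT}) :
    ab_max G A -> A <| G -> #|G : A| = 4 -> n_centralizer 9 G -> cyclic (G / A).
Proof.
move=> maxA nsAG iA n9; apply: contraT => ncQ; have [sAG abA _] := maxA.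
have nabG := nine_cent_nonabelian n9; have {}n9: ncent G G = 9 := n9.
have [cAZ | ] := boolP [forall t in G :\: A, 'C_A[t] \subset 'Z(G)]; last first.
  rewrite negb_forall_in => /exists_inP[t GAt nCtZ].
  by have := klein_ncent_noncentral maxA nsAG iA ncQ GAt nCtZ; rewrite n9.
suff: 2 %| ncent G G by rewrite n9.
apply: (klein_ncent_even nsAG abA iA ncQ) => [|t GAt]; last exact: (forall_inP cAZ).
exact: ab_max_center_proper maxA nabG.
Qed.

(** * Cyclic quotients by an abelian subgroup *)

(** The group [C_G(t)] has a central subgroup, its intersection with [A], with
    cyclic quotient. *)
Lemma cyclic_cent1_abelian (gT : finGroupType) (G A : {group gT}) t :
  A <| G -> cyclic (G / A) -> 'C_A[t] \subset 'Z(G) -> abelian 'C_G[t].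
Proof.
move=> /andP[sAG nAG] cycQ cAZ.
have sCG: 'C_G[t] \subset G := subsetIl _ _.
have nAC: 'C_G[t] \subset 'N(A) := subset_trans sCG nAG.
have sIZ: A :&: 'C_G[t] \subset 'Z('C_G[t]).
  rewrite subsetI subsetIr setIA (setIidPl sAG) (subset_trans cAZ) //.
  by rewrite (subset_trans (subsetIr G _)) // centS.
apply: (cyclic_factor_abelian sIZ).
by rewrite (isog_cyclic (second_isog nAC)) (cyclicS (quotientS A sCG)).
Qed.

Lemma cyclic_quotient_gen (gT : finGroupType) (G A : {group gT}) :
    A <| G -> cyclic (G / A) ->
  exists2 y, y \in G & forall t, t \in G -> exists i, (y ^+ i)^-1 * t \in A.
Proof.
case/andP=> sAG nAG /cyclicP[Y defQ].
have /morphimP[y Ny Gy defY]: Y \in G / A by rewrite defQ cycle_id.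
exists y => // t Gt; have Nt := subsetP nAG t Gt.
have: coset A t \in <[Y]> by rewrite -defQ mem_quotient.
case/cycleP=> i defYt; exists i; apply: coset_idr.
  by rewrite groupM ?groupV ?groupX.
by rewrite morphM ?groupV ?groupX // morphV ?groupX // morphX //= -defY -defYt mulVg.
Qed.

(** Let [y] generate [G] modulo [A]. All centralizers of elements outside [A] are
    abelian, so such elements have the same centralizer as soon as they commute.
    If [y ^+ i] is not in [A] then the map from [a] to [(y * a) ^+ i] is injective
    modulo the centre, so it reaches the whole coset of [y ^+ i]. Hence every element
    outside [A] commutes, up to the centre, with some [y * a], and only the
    centralizers of the [y * a] have to be counted; they correspond to the cosets
    of [Z(G)] in [A]. *)
Lemma cyclic_quotient_ncent (gT : finGroupType) (G A : {group gT}) :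
    A <| G -> abelian A -> cyclic (G / A) -> 'Z(G) \proper A ->
    {in G :\: A, forall t, 'C_A[t] \subset 'Z(G)} ->
  ncent G G = (#|A : 'Z(G)|).+2.
Proof.
move=> nsAG abA cycQ ltZA cAZ; have [sAG nAG] := andP nsAG; have sZA := proper_sub ltZA.
rewrite (ncent_setD sAG abA ltZA cAZ); congr _.+2.
have abC t : t \in G :\: A -> abelian 'C_G[t].
  by move=> GAt; apply: cyclic_cent1_abelian (cAZ t GAt).
have [y Gy powA] := cyclic_quotient_gen nsAG cycQ; have Ny := subsetP nAG y Gy.
have nAy: y \notin A.
  apply: contraL ltZA => Ay; suff: A \subset 'Z(G) by move=> sAZ; rewrite properE sAZ andbF.
  rewrite subsetI sAG centsC; apply: subset_trans abA; apply/subsetP=> t Gt.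
  have [i Ait] := powA t Gt; rewrite -(mulKVg (y ^+ i) t) groupM //.
  exact: groupX.
have GAya a : a \in A -> y * a \in G :\: A.
  by move=> Aa; rewrite inE groupMr // nAy groupM // (subsetP sAG).
have nZG := normal_norm (center_normal G).
have onto t : t \in G :\: A -> exists2 a, a \in A & 'C_G[t] = 'C_G[y * a].
  case/setDP=> Gt nAt; have [i Ait] := powA t Gt.
  pose f a := coset 'Z(G) ((y * a) ^+ i).
  have Gya a : a \in A -> y * a \in G by case/GAya/setDP.
  have Aya a : a \in A -> (y ^+ i)^-1 * (y * a) ^+ i \in A.
    move=> Aa; have Nya := subsetP nAG _ (Gya a Aa); apply: coset_idr.
      by rewrite groupM ?groupV ?groupX.
    rewrite morphM ?groupV ?groupX // morphV ?groupX // !morphX //.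
    by rewrite morphM ?(subsetP nAG a (subsetP sAG a Aa)) //= (coset_id Aa) mulg1 mulVg.
  have nAi a : a \in A -> (y * a) ^+ i \notin A.
    move=> Aa; apply: contra nAt => Ai; rewrite -(mulKVg (y ^+ i) t) groupMr //.
    by rewrite -(groupMr (y ^+ i) (Aya a Aa)) mulKVg.
  have eqCf v a : v \in G :\: A -> a \in A -> coset 'Z(G) v = f a -> 'C_G[v] = 'C_G[y * a].
    move=> GAv Aa eqf; have [Gv nAv] := setDP GAv; have Gya' := Gya a Aa.
    apply: cent1_eq_abelian; rewrite ?abC ?GAya //.
    rewrite -(mulgKV ((y * a) ^+ i) v) groupM ?groupX ?cent1id //.
    apply: (subsetP (sub_center_cent1 Gya')); apply: coset_idr.
      by rewrite (subsetP nZG) // groupM ?groupV ?groupX.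
    rewrite morphM ?morphV ?(subsetP nZG) ?groupV ?groupX //= eqf.
    exact: mulgV.
  have GAi a : a \in A -> (y * a) ^+ i \in G :\: A.
    by move=> Aa; rewrite inE nAi ?groupX ?Gya.
  have commf a b : a \in A -> b \in A -> f a = f b -> 'C_G[y * b] = 'C_G[y * a].
    by move=> Aa Ab eqf; rewrite -(eqCf _ b (GAi b Ab) Ab) // (eqCf _ a) ?GAi.
  have leZ: {in A, forall a, #|[set b in A | f b == f a]| <= #|'Z(G)|}.
    move=> a Aa; rewrite -(card_lcoset 'Z(G) a); apply/subset_leq_card/subsetP=> b.
    rewrite inE => /andP[Ab /eqP eqf]; rewrite mem_lcoset.
    have eqC := commf b a Ab Aa eqf.
    apply: (subsetP (cAZ (y * a) (GAya a Aa))); rewrite inE groupM ?groupV //=.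
    have ->: a^-1 * b = (y * a)^-1 * (y * b) by rewrite invMg -mulgA mulKg.
    rewrite groupM ?groupV ?cent1id // cent1C.
    exact: (same_cent_commute (Gya a Aa) eqC).
  have imf: f @: A = coset 'Z(G) (y ^+ i) *: (A / 'Z(G)).
    apply/eqP; rewrite eqEcard; apply/andP; split.
      apply/subsetP=> _ /imsetP[a Aa ->]; rewrite mem_lcoset /f.
      rewrite -morphV ?(subsetP nZG) ?groupX // -morphM ?(subsetP nZG) ?groupV ?groupX ?Gya //.
      by rewrite mem_quotient ?Aya.
    rewrite card_lcoset card_quotient ?(subset_trans sAG) //.
    rewrite -(leq_pmul2r (cardG_gt0 'Z(G))) mulnC Lagrange //.
    exact: leq_card_fibres.
  have /imsetP[a Aa ft]: coset 'Z(G) t \in f @: A.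
    rewrite imf mem_lcoset -morphV ?(subsetP nZG) ?groupX //.
    by rewrite -morphM ?(subsetP nZG) ?groupV ?groupX // mem_quotient.
  by exists a; rewrite // (eqCf t a) // inE nAt.
have GyA: y *: A \subset G by rewrite mul_subG ?sub1set.
have defX: [set 'C_G[x] | x in G :\: A] = [set 'C_G[x] | x in y *: A].
  apply/eqP; rewrite eqEsubset; apply/andP; split; apply/subsetP.
    move=> _ /imsetP[t GAt ->]; have [a Aa ->] := onto t GAt.
    by apply: imset_f; rewrite mem_lcoset mulKg.
  move=> _ /imsetP[_ /lcosetP[a Aa ->] ->].
  exact/imset_f/GAya.
rewrite /ncent defX; apply/eqP; rewrite eqn_leq leq_ncent_lcoset //=.
rewrite -(leq_pmul2r (cardG_gt0 'Z(G))) mulnC Lagrange // -(card_lcoset A y).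
apply: (@leq_ncent_cosets _ G A (y *: A)) => //.
  move=> _ _ /lcosetP[c Ac ->] /lcosetP[d Ad ->] _.
  by rewrite invMg -mulgA mulKg groupM ?groupV.
by move=> _ /lcosetP[a Aa ->]; apply/subset_leq_card/cAZ/GAya.
Qed.

(** If an element outside [A] centralises a noncentral element of [A], then so does
    a power of a generator [y] modulo [A]; this power and [y] form a commuting pair
    with too many centralizers. *)
Lemma cyclic_nine_cent (gT : finGroupType) (G A : {group gT}) :
    ab_max G A -> A <| G -> cyclic (G / A) -> n_centralizer 9 G ->
  {in G :\: A, forall t, 'C_A[t] \subset 'Z(G)} /\ #|A : 'Z(G)| = 7.
Proof.
move=> maxA nsAG cycQ n9; have [sAG abA _] := maxA.
have ltZA := ab_max_center_proper maxA (nine_cent_nonabelian n9).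
have {}n9: ncent G G = 9 := n9.
have [y Gy powA] := cyclic_quotient_gen nsAG cycQ.
suff cAZ: {in G :\: A, forall t, 'C_A[t] \subset 'Z(G)}.
  split=> //; have := cyclic_quotient_ncent nsAG abA cycQ ltZA cAZ.
  by rewrite n9 => -[].
move=> t /setDP[Gt nAt]; apply: contraT => nCtZ.
have [i Ait] := powA t Gt; have Ati : t^-1 * y ^+ i \in A by rewrite -groupV invMg invgK.
have nAyi: y ^+ i \notin A.
  by apply: contra nAt => Ayi; rewrite -(mulKVg (y ^+ i) t) groupM.
have nAy: y \notin A by apply: contra nAyi; apply: groupX.
suff: 10 <= ncent G G by rewrite n9.
apply: (@ncent_commuting_pair _ G A (y ^+ i) y) => //.
- by rewrite inE nAyi groupX.
- by rewrite inE nAy.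
- by rewrite cent1C groupX ?cent1id.
- apply/subsetP=> d /setIP[Ad cyd]; rewrite inE (subsetP sAG) //= -sub_cent1.
  apply/subsetP=> u Gu; have [j Aju] := powA u Gu; rewrite -(mulKVg (y ^+ j) u).
  rewrite groupM ?groupX 1?cent1C //.
  by apply/cent1P; apply: (centsP abA).
by rewrite -(mulKVg t (y ^+ i)) cent1_lcoset.
Qed.

(** * The structure of the central quotient *)

Lemma isog_C7xC7 (gT : finGroupType) (Q : {group gT}) :
  #|Q| = 49 -> ~~ cyclic Q -> Q \isog setX (Zp 7) (Zp 7).
Proof.
move=> oQ ncQ.
have pQ: 7.-group Q by rewrite /pgroup oQ.
have abQ: abelian Q by apply: (p2group_abelian pQ); rewrite oQ.
have abelQ: 7.-abelem Q.
  rewrite abelemE // abQ /=; apply/exponentP=> x Qx.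
  apply/eqP; rewrite -order_dvdn; have := order_dvdG Qx; rewrite oQ.
  case/(@dvdn_pfactor 7 _ 2 isT) => [[|[|[|]]]] // _ ox; rewrite ?ox //.
  case/negP: ncQ; apply/cyclicP; exists x; apply/eqP.
  by rewrite eq_sym eqEcard cycle_subG Qx oQ -[#|<[x]>|]/#[x] ox.
have oZ: #|setX (Zp 7) (Zp 7)| = 49 by rewrite cardsX card_Zp.
rewrite (isog_abelem_card _ abelQ) /= oZ oQ eqxx andbT.
rewrite abelemE //; apply/andP; split.
  by apply/centsP=> -[a b] _ [c d] _; congr pair; apply: Zp_mulgC.
have exp7 (a : 'Z_7) : a ^+ 7 = 1.
  apply/eqP; rewrite -order_dvdn; have := order_dvdG (in_setT a).
  by rewrite cardsT card_ord.
apply/exponentP=> -[a b] _; rewrite -[1]/((1 : 'Z_7), (1 : 'Z_7)) -{1}(exp7 a) -(exp7 b).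
by rewrite !expgS.
Qed.

(** The central commutator of [a] and [c] has order dividing both [n] and [m]. *)
Lemma coprime_central_commg (gT : finGroupType) (G A : {group gT}) a c n m :
    A \subset G -> abelian A -> a \in A -> c \in G ->
    [~ a, c] \in 'Z(G) -> coprime n m -> a ^+ n \in 'Z(G) -> c ^+ m \in A ->
  a \in 'C[c].
Proof.
move=> sAG abA Aa Gc Zac co_nm Zan Acm; have Ga := subsetP sAG a Aa.
have cZ x : x \in G -> commute x [~ a, c].
  by move=> Gx; apply/cent1P; rewrite cent1C; apply: (subsetP (sub_center_cent1 Gx)).
have an1 : [~ a, c] ^+ n = 1.
  rewrite -commXg; last exact: cZ.
  by apply/eqP/commgP/cent1P; apply: (subsetP (sub_center_cent1 Gc)).
have cm1 : [~ a, c] ^+ m = 1.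
  rewrite -commgX; last exact: cZ.
  by apply/eqP/commgP; apply: (centsP abA).
apply/cent1P/commgP; rewrite -order_eq1 -dvdn1 -(eqP co_nm) dvdn_gcd.
by rewrite !order_dvdn an1 cm1 eqxx.
Qed.

(** If [G / A] has order 7 then [G / Z(G)] has order 49 and is not cyclic, as [G] is
    not abelian. Otherwise the centralizer of a generator modulo [A] provides a
    complement of [A / Z(G)] in [G / Z(G)], which by coprimeness acts without fixed
    points. So [G / Z(G)] is a Frobenius group with kernel of order 7, whose
    complement has an order dividing 6. *)
Lemma nine_cent_structure (gT : finGroupType) (G A : {group gT}) :
    A <| G -> abelian A -> cyclic (G / A) -> 'Z(G) \proper A ->
    {in G :\: A, forall t, 'C_A[t] \subset 'Z(G)} ->
    #|A : 'Z(G)| = 7 -> 1 < #|G : A| <= 7 ->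
  [\/ is_nontrivial_sdprod_cyclic 7 2 (G / 'Z(G))%G,
      is_nontrivial_sdprod_cyclic 7 3 (G / 'Z(G))%G,
      is_Frobenius_cyclic 6 7 (G / 'Z(G))%G
    | (G / 'Z(G)) \isog setX (Zp 7) (Zp 7)].
Proof.
move=> nsAG abA cycQ ltZA cAZ iAZ /andP[iA_gt1]; have [sAG nAG] := andP nsAG.
have sZA := proper_sub ltZA; have nZG := normal_norm (center_normal G).
have oQ: #|G / 'Z(G)| = (#|G : A| * 7)%N.
  by rewrite card_quotient // -(Lagrange_index sAG sZA) iAZ.
rewrite leq_eqVlt => /orP[/eqP iA7 | iA_lt7].
  constructor 4; apply: isog_C7xC7; first by rewrite oQ iA7.
  apply: contraL ltZA => /(cyclic_factor_abelian (subxx _))/center_idP defG.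
  by rewrite defG properE sAG andbF.
have [y Gy powA] := cyclic_quotient_gen nsAG cycQ.
have nAy: y \notin A.
  rewrite indexg_gt1 in iA_gt1; apply: contra iA_gt1 => Ay; apply/subsetP=> t Gt.
  have [i Ait] := powA t Gt; rewrite -(mulKVg (y ^+ i) t) groupM //.
  exact: groupX.
pose C := 'C_G[y]%G.
have sZC: 'Z(G) \subset C by rewrite subsetI center_sub sub_center_cent1.
have CIA: C :&: A = 'Z(G).
  apply/eqP; rewrite eqEsubset subsetI sZC sZA !andbT setIAC (setIidPr sAG).
  by apply: cAZ; rewrite inE nAy.
have AC: A * C = G.
  apply/eqP; rewrite eqEsubset mul_subG ?subsetIl //=; apply/subsetP=> t Gt.
  have <- : C * A = A * C by apply/normC/(subset_trans (subsetIl _ _)).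
  have [i Ait] := powA t Gt; rewrite -(mulKVg (y ^+ i) t) mem_mulg //.
  by rewrite groupX // inE Gy cent1id.
have iC: #|C : 'Z(G)| = #|G : A|.
  by rewrite -CIA indexgI -AC indexMg.
pose K := (A / 'Z(G))%G; pose H := (C / 'Z(G))%G.
have oK: #|K| = 7 by rewrite card_quotient // (subset_trans sAG).
have oH: #|H| = #|G : A| by rewrite card_quotient // (subset_trans (subsetIl _ _)).
have defQ: K ><| H = G / 'Z(G).
  rewrite sdprodE.
  - by rewrite -quotientMl ?AC // (subset_trans sAG).
  - by rewrite quotient_norms // (subset_trans (subsetIl _ _)).
  by rewrite -quotientGI // setIC CIA trivg_quotient.
have cycH: cyclic H.
  have sCG: C \subset G := subsetIl _ _.
  have := second_isog (subset_trans sCG nAG); rewrite setIC CIA => isoH.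
  by rewrite (isog_cyclic isoH) (cyclicS (quotientS A sCG)).
have ntK: K :!=: 1 by rewrite trivg_card1 oK.
have ntH: H :!=: 1 by rewrite trivg_card1 oH neq_ltn iA_gt1 orbT.
have frobQ: [Frobenius G / 'Z(G) = K ><| H].
  apply/Frobenius_semiregularP => // x /setD1P[ntc /morphimP[c Nc /setIP[Gc cyc] defc]].
  rewrite {x}defc in ntc *.
  apply/trivgP/subsetP=> _ /setIP[/morphimP[a Na Aa ->] cca]; apply/set1P.
  have Ga := subsetP sAG a Aa.
  have nAc: c \notin A.
    apply: contra ntc => Ac; apply/eqP/coset_id.
    by rewrite -CIA in_setI Ac andbT; apply/setIP.
  have GAc: c \in G :\: A by rewrite inE nAc.
  apply: coset_id; apply: (subsetP (cAZ c GAc)); rewrite inE Aa /=.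
  apply: (coprime_central_commg (n := 7) (m := #|G : A|) sAG abA Aa Gc).
  - apply: coset_idr; first by rewrite groupR.
    by rewrite morphR //; apply/eqP/commgP/cent1P.
  - by rewrite prime_coprime // gtnNdvd // ltnW.
  - by rewrite -iAZ expg_index // (normalS sZA sAG (center_normal G)).
  exact: expg_index.
have dvd6: #|G : A| %| 6.
  by have := Frobenius_dvd_ker1 frobQ; rewrite oK oH.
have isoZp (L : {group coset_of 'Z(G)}) k : 1 < k -> cyclic L -> #|L| = k -> L \isog Zp k.
  move=> k_gt1 cycL oL; rewrite (isog_cyclic_card _ cycL) oL card_Zp ?eqxx ?andbT 1?ltnW //.
  by rewrite /= /Zp k_gt1; apply/cyclicP; exists (Zp1 : 'Z_k); apply: Zp_cycle.
have isoK: K \isog Zp 7 by apply: isoZp => //; apply: prime_cyclic; rewrite oK.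
have isoH: H \isog Zp #|G : A| by apply: isoZp.
have sdp: ~~ (H \subset 'C(K)).
  have [x Hx ntx] := trivgPn _ ntH; apply/negP => /subsetP/(_ x Hx) cKx.
  case/eqP: ntK; rewrite -(Frobenius_reg_ker frobQ (x := x)) ?inE ?ntx //.
  by apply/esym/setIidPl; rewrite sub_cent1.
move: isoH dvd6 iA_gt1 iA_lt7; move: #|G : A| => [|[|[|[|[|[|[|m]]]]]]] // isoH _ _ _.
- by constructor 1; exists K, H.
- by constructor 2; exists K, H.
by constructor 3; exists K, H.
Qed.

Lemma nine_cent_quotient (gT : finGroupType) (G : {group gT}) :
  n_centralizer 9 G ->
  [\/ is_nontrivial_sdprod_cyclic 7 2 (G / 'Z(G))%G,
      is_nontrivial_sdprod_cyclic 7 3 (G / 'Z(G))%G,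
      is_Frobenius_cyclic 6 7 (G / 'Z(G))%G
    | (G / 'Z(G)) \isog setX (Zp 7) (Zp 7)].
Proof.
move=> n9; have [A [maxA nsAG iA]] := nine_cent_normal_ab_max n9.
have [sAG abA _] := maxA; have oQ: #|G / A| = #|G : A| by rewrite card_quotient ?normal_norm.
have cycQ: cyclic (G / A).
  have [prA | nprA] := boolP (prime #|G : A|); first by apply: prime_cyclic; rewrite oQ.
  have i46: #|G : A| = 4 \/ #|G : A| = 6.
    move: nprA iA; case: #|_ : _| => [|[|[|[|[|[|[|[|n]]]]]]]] //; first by left.
    by right.
  case: i46 => iA4; first exact: nine_cent_index4_cyclic maxA nsAG iA4 n9.
  have [abQ | nabQ] := boolP (abelian (G / A)).
    by apply: abelian_order6_cyclic; rewrite ?oQ.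
  by have := order6_nonabelian_ncent maxA nsAG iA4 nabQ; rewrite [ncent _ _]n9.
have [cAZ iAZ] := cyclic_nine_cent maxA nsAG cycQ n9.
apply: (nine_cent_structure nsAG abA cycQ _ cAZ iAZ iA).
exact: ab_max_center_proper maxA (nine_cent_nonabelian n9).
Qed.

(** * Groups with exactly nine centralizers *)

(** This is the count for cyclic quotients, which gives [7 + 2]. *)
Lemma nine_cent_of_kernel (gT : finGroupType) (G A : {group gT}) :
    A <| G -> cyclic (G / A) -> 'Z(G) \subset A -> #|A : 'Z(G)| = 7 ->
    {in G :\: A, forall t, 'C_A[t] \subset 'Z(G)} ->
  n_centralizer 9 G.
Proof.
move=> nsAG cycQ sZA iAZ cAZ; have sAG := normal_sub nsAG.
have abA: abelian A.
  apply: (@cyclic_factor_abelian _ 'Z(G)).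
    by rewrite subsetI sZA (subset_trans (subsetIr G _)) // centS.
  by apply: prime_cyclic; rewrite card_quotient ?iAZ // (subset_trans sAG) ?normal_norm ?center_normal.
have ltZA: 'Z(G) \proper A by rewrite properE sZA -indexg_eq1 iAZ.
by rewrite /n_centralizer -[#|_|]/(ncent G G) (cyclic_quotient_ncent nsAG abA cycQ ltZA cAZ) iAZ.
Qed.

(** The preimage of [K] is the abelian normal subgroup to which the count applies. *)
Lemma nine_cent_of_quotient_kernel (gT : finGroupType) (G : {group gT})
    (K : {group coset_of 'Z(G)}) :
    K <| G / 'Z(G) -> #|K| = 7 -> cyclic (G / 'Z(G) / K) ->
    {in K^#, forall k, 'C_(G / 'Z(G))[k] \subset K} ->
  n_centralizer 9 G.
Proof.
move=> nsKQ oK cycQK cK; have [sKQ nKQ] := andP nsKQ; have nsZG := center_normal G.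
have [A defK sZA nsAG] := inv_quotientN nsZG nsKQ.
have sAG := normal_sub nsAG; have nZG := normal_norm nsZG.
have nsZA: 'Z(G) <| A := normalS sZA sAG nsZG.
apply: (nine_cent_of_kernel nsAG) => //.
- by rewrite -(isog_cyclic (third_isog sZA nsZG nsAG)) -defK.
- by rewrite -card_quotient ?normal_norm // -defK.
move=> t /setDP[Gt nAt]; apply/subsetP=> a /setIP[Aa cta]; apply: contraR nAt => nZa.
have [Nt Na] := (subsetP nZG t Gt, subsetP (normal_norm nsZA) a Aa).
rewrite -(mem_quotientE nsZA) // -defK; apply: (subsetP (cK (coset 'Z(G) a) _)).
  rewrite in_setD1; apply/andP; split; last by rewrite defK mem_quotient.
  by apply: contra nZa => /eqP/coset_idr; apply.
rewrite inE mem_quotient //=; apply/cent1P/commgP; rewrite -morphR //.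
have /eqP-> : [~ t, a] == 1 by apply/commgP/commute_sym/cent1P.
by rewrite morph1.
Qed.

Lemma nine_cent_of_Frobenius (gT : finGroupType) (G : {group gT})
    (K H : {group coset_of 'Z(G)}) :
    [Frobenius G / 'Z(G) = K ><| H] -> #|K| = 7 -> cyclic H -> n_centralizer 9 G.
Proof.
move=> frobQ oK cycH; have [defQ _ _ _ _] := Frobenius_context frobQ.
have [nsKQ _ _ _ _] := sdprod_context defQ.
apply: (nine_cent_of_quotient_kernel nsKQ oK).
  by rewrite -(isog_cyclic (sdprod_isog defQ)).
exact: Frobenius_cent1_ker frobQ.
Qed.

(** As [q] is prime, the centralizer of a nontrivial element of the kernel [K] is
    [K] or everything, and the second is excluded because [K] has prime order and is
    not central. *)
Lemma nine_cent_of_sdprod (gT : finGroupType) (G : {group gT}) q :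
    prime q -> is_nontrivial_sdprod_cyclic 7 q (G / 'Z(G))%G ->
  n_centralizer 9 G.
Proof.
move=> q_pr [K [H [defQ isoK isoH ncHK]]].
have oK: #|K| = 7 by rewrite (card_isog isoK) card_Zp.
have oH: #|H| = q by rewrite (card_isog isoH) card_Zp ?prime_gt0.
have [nsKQ sHQ defKH nKH tiKH] := sdprod_context defQ.
have cycH: cyclic H by apply: prime_cyclic; rewrite oH.
have abK: abelian K by apply/cyclic_abelian/prime_cyclic; rewrite oK.
apply: (nine_cent_of_quotient_kernel nsKQ oK).
  by rewrite -(isog_cyclic (sdprod_isog defQ)).
move=> k /setD1P[ntk Kk].
have iK: #|(G / 'Z(G))%G : K| = q.
  by rewrite -divgS ?(normal_sub nsKQ) // -(sdprod_card defQ) mulKn ?cardG_gt0.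
have pK: prime #|(G / 'Z(G))%G : K| by rewrite iK.
have sKC: K \subset 'C_(G / 'Z(G))[k].
  by rewrite subsetI (normal_sub nsKQ) sub_cent1 (subsetP abK).
have [eqC | -> //] := prime_index_between pK sKC (subsetIl _ _).
case/negP: ncHK; apply: subset_trans sHQ _; rewrite centsC.
apply: prime_meetG; rewrite ?oK //; apply/trivgPn; exists k => //.
by rewrite inE Kk -sub_cent1; apply/setIidPl.
Qed.

(** Any subgroup of order 7 of [G / Z(G)] serves as kernel: its preimage [A] is
    abelian of prime index, and an element outside [A] centralises in [A] either
    [Z(G)] or all of [A], and the latter would make [A] central. *)
Lemma nine_cent_of_order49 (gT : finGroupType) (G : {group gT}) :
  #|G : 'Z(G)| = 49 -> n_centralizer 9 G.
Proof.
move=> iZ; have nsZG := center_normal G; have nZG := normal_norm nsZG.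
have oQ: #|G / 'Z(G)| = 49 by rewrite card_quotient.
have [|x Qx ox] := @Cauchy _ 7 (G / 'Z(G))%G isT; first by rewrite /= oQ.
have pQ: 7.-group (G / 'Z(G)) by rewrite /pgroup oQ.
have abQ: abelian (G / 'Z(G)) by apply: (p2group_abelian pQ); rewrite oQ.
have nsXQ: <[x]> <| G / 'Z(G) by rewrite -sub_abelian_normal // cycle_subG.
have [A defX sZA nsAG] := inv_quotientN nsZG nsXQ.
have sAG := normal_sub nsAG.
have iAZ: #|A : 'Z(G)| = 7.
  by rewrite -card_quotient ?(subset_trans sAG) // -defX -ox.
have iA: #|G : A| = 7.
  by apply/eqP; rewrite -(eqn_pmul2r (isT : 0 < 7)) -{1}iAZ Lagrange_index // iZ.
have pA: prime #|G : A| by rewrite iA.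
have pAZ: prime #|A : 'Z(G)| by rewrite iAZ.
apply: (nine_cent_of_kernel nsAG) => //.
  by apply: prime_cyclic; rewrite card_quotient ?normal_norm.
have abA: abelian A.
  apply: (@cyclic_factor_abelian _ 'Z(G)).
    by rewrite subsetI sZA (subset_trans (subsetIr G _)) // centS.
  by rewrite /= -defX cycle_cyclic.
move=> t /setDP[Gt nAt].
have sZC: 'Z(G) \subset 'C_A[t] by rewrite subsetI sZA sub_center_cent1.
have [eqC | -> //] := prime_index_between pAZ sZC (subsetIl _ _).
have sAZ: A \subset 'Z(G).
  rewrite subsetI sAG centsC -(prime_index_adjoin pA sAG Gt nAt) join_subG.
  by rewrite (abA : A \subset 'C(A)) cycle_subG -sub_cent1; apply/setIidPl.
by have := indexg_eq1 A 'Z(G); rewrite iAZ sAZ.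
Qed.

Theorem theorem2p1 (gT : finGroupType) (G : {group gT}) :
  n_centralizer 9 G <->
  [\/ is_nontrivial_sdprod_cyclic 7 2 (G / 'Z(G))%G,
      is_nontrivial_sdprod_cyclic 7 3 (G / 'Z(G))%G,
      is_Frobenius_cyclic 6 7 (G / 'Z(G))%G
    | (G / 'Z(G)) \isog setX (Zp 7) (Zp 7)].
Proof.
split; first exact: nine_cent_quotient.
case=> [sdQ | sdQ | [K [H [frobQ isoH isoK]]] | isoQ].
- exact: nine_cent_of_sdprod sdQ.
- exact: nine_cent_of_sdprod sdQ.
- apply: (nine_cent_of_Frobenius frobQ).
    by rewrite (card_isog isoK) card_Zp.
  by rewrite (isog_cyclic isoH) /= /Zp /=; apply/cyclicP; exists (Zp1 : 'Z_6); apply: Zp_cycle.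
apply: nine_cent_of_order49; rewrite -card_quotient ?normal_norm ?center_normal //.
by rewrite (card_isog isoQ) cardsX card_Zp.
Qed.
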